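(* Let $\{w_k\}_{k\ge 0}$ be generated by Byzantine Resilient SGD, i.e. $w_{k+1}=w_k-\alpha_k A_k$ with $A_k=\mathrm{Agg}((\tilde g_1)_k,\dots,(\tilde g_m)_k)$, for the problem $\min_{w\in\mathbb{R}^d}F(w)=\frac1m\sum_{i=1}^m F_i(w)$, with the setting, notation and algorithm as described in the context. Suppose the following hold. 1. (Smoothness) Each term $F_i$ of the objective is $L$-smooth (continuously differentiable with $L$-Lipschitz gradient) and bounded below by $F_{\text{low}}\in\mathbb{R}$. 2. (Expected smoothness) For all $k$, $\mathbb{E}_k[G(w_k)]=\nabla F(w_k)$, and there are constants $A,B,C\ge 0$ independent of $k$ such that for all $k$ $$\mathbb{E}_k[\|G(w_k)\|^2]\le 2A(F(w_k)-F_{\text{low}})+B\|\nabla F(w_k)\|^2+C.$$ 3. ($\alpha$-Byzantine resilience) There is a constant angle $\alpha\in[0,\pi/2)$ such that for all $k$: (i) $\langle\mathbb{E}_k[A_k],\nabla F(w_k)\rangle\ge(1-\sin(\alpha))\|\nabla F(w_k)\|^2$; and (ii) for $r=2,3,4$, $\mathbb{E}_k[\|A_k\|^r]$ is bounded above by a linear combination (with coefficients independent of $k$) of terms $\mathbb{E}_k[\|G(w_k)\|^{r_1}]\cdots\mathbb{E}_k[\|G(w_k)\|^{r_n}]$ with $r_1+\dots+r_n=r$. Let $E$ be a constant such that $\mathbb{E}_k[\|A_k\|^2]\le E\,\mathbb{E}_k[\|G(w_k)\|^2]$ for all $k$ (such a constant exists by 3(ii) with $r=2$), and let $A'=AE$,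 $B'=BE$, $C'=CE$, with $LB'>0$. Let the learning rates be $$\alpha_k=\frac{1-\sin(\alpha)}{LB'(k+1)^p},\qquad k=0,1,2,\dots,$$ for some $p\in(1/2,1)$. Put $Q_K=\sum_{k=0}^{K-1}\alpha_k^2$ and $\delta_0=F(w_0)-F_{\text{low}}$. Then for every $K\ge1$ $$\min_{0\le k\le K-1}\mathbb{E}[\|\nabla F(w_k)\|]\le\left(\frac{e^{LA'Q_K}\left(2\delta_0+LC'Q_K\right)}{(1-\sin(\alpha))K\alpha_{K-1}}\right)^{1/2}.$$ In particular, $$\min_{0\le k\le K-1}\mathbb{E}[\|\nabla F(w_k)\|]=\mathcal{O}\left(e^{A'/(2L(B')^2)}\left(2\delta_0+\frac{C'}{L(B')^2}\right)^{1/2}(LB')^{1/2}\frac{1}{K^{(1-p)/2}}\right)$$ as $K\to\infty$, considering the dependency in terms of $K$, $\delta_0$, $A'$, $B'$, $C'$ and $L$ (that is, the constant hidden in $\mathcal{O}$ does not depend on these quantities).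
   Context: $\|\cdot\|$ and $\langle\cdot,\cdot\rangle$ are the Euclidean norm and inner product on $\mathbb{R}^d$. Problem. There are $m$ nodes; node $i$ holds a dataset $\{((x_i)_j,(y_i)_j)\}_{j=1}^{n_i}$ and $F_i(w)=\frac1{n_i}\sum_{j=1}^{n_i} l((y_i)_j,f((x_i)_j;w))$ is the empirical risk at node $i$ of a model $f(\cdot;w)$ with parameter $w\in\mathbb{R}^d$, $l$ being a loss function. The objective is $F=\frac1m\sum_{i=1}^m F_i$. Stochastic gradients. All random quantities live on a probability space. At iteration $k$, node $i$ draws a sample $(\zeta_k)_i$, and the correct gradient estimate of node $i$ is $(g_i)_k=g_i(w_k)=G(w_k,(\zeta_k)_i)$, where $G(w,\zeta)$ is a common random gradient model, not depending on the node. The data are i.i.d. across nodes, so the (conditional) law of $g_i(w_k)$ is the same for all $i$; $G(w_k)$ denotes a generic such estimate, so that $\mathbb{E}_k[G(w_k)]$ and $\mathbb{E}_k[\|G(w_k)\|^r]$ are the common values of $\mathbb{E}_k[g_i(w_k)]$ and $\mathbb{E}_k[\|g_i(w_k)\|^r]$. $\mathcal{F}_k$ is the $\sigma$-algebra generated by all samples $(\zeta_i)_j$ with $0\le i\le k-1$, $1\le j\le m$, and $\mathbb{E}_k[\cdot]=\mathbb{E}[\cdot\mid\mathcal{F}_k]$. The iterate $w_k$ is $\mathcal{F}_k$-measurable. Byzantine adversaries. At each iteration $k$, $q$ of the $m$ nodes are Byzantine (the set may change with $k$). The server receives $(\tilde g_i)_k=(B_i)_k$ if node $i$ is Byzantine,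 and $(\tilde g_i)_k=(g_i)_k$ otherwise; $(B_i)_k\in\mathbb{R}^d$ is arbitrary and may depend on $(g_1)_k,\dots,(g_m)_k$, on the current iterate and step size, and on any previous information. Algorithm (Byzantine Resilient SGD). Input: initial point $w_0\in\mathbb{R}^d$ (deterministic), learning rates $\alpha_k>0$, and an aggregation function $\mathrm{Agg}:(\mathbb{R}^d)^m\to\mathbb{R}^d$. For $k=0,1,2,\dots$: compute $A_k=\mathrm{Agg}((\tilde g_1)_k,\dots,(\tilde g_m)_k)$ and set $w_{k+1}=w_k-\alpha_kA_k$. The angle $\alpha$ (no subscript) is unrelated to the learning rates $\alpha_k$. *)

(* Defs.v *)
From mathcomp Require Import all_boot all_order all_algebra.
From mathcomp Require Import all_classical all_reals all_analysis measurable_realfun.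

Set Implicit Arguments.
Unset Strict Implicit.
Unset Printing Implicit Defensive.

Import Order.TTheory GRing.Theory Num.Theory.
Import numFieldNormedType.Exports.

Local Open Scope classical_set_scope.
Local Open Scope ring_scope.

(* The library norm on ['rV[R]_d] is the sup norm: the Euclidean one has to be
   introduced.  Topology, differentiability and Borel sets do not depend on
   this choice. *)
Definition inner (R : realType) (d : nat) (u v : 'rV[R]_d) : R :=
  \sum_(i < d) u 0 i * v 0 i.

Definition enorm (R : realType) (d : nat) (u : 'rV[R]_d) : R :=
  Num.sqrt (inner u u).

Definition grad (R : realType) (d : nat) (F : 'rV[R]_d -> R) (w : 'rV[R]_d) :
    'rV[R]_d :=
  \row_(i < d) 'D_(delta_mx 0 i) F w.

Definition smooth (R : realType) (d : nat) (L : R) (F : 'rV[R]_d -> R) : Prop :=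
  [/\ forall w, differentiable F w,
      continuous (grad F)
    & forall v w, enorm (grad F v - grad F w) <= L * enorm (v - w)].

Definition empirical_risk (R : realType) (d : nat) (X Y V : Type)
    (l : Y -> V -> R) (f : X -> 'rV[R]_d -> V)
    (n : nat) (x : 'I_n -> X) (y : 'I_n -> Y) (w : 'rV[R]_d) : R :=
  n%:R^-1 * \sum_(j < n) l (y j) (f (x j) w).

Definition borel (T : topologicalType) : set (set T) :=
  <<s [set U : set T | open U] >>.

(* [V] is a random vector measurable with respect to the sigma-algebra [S]. *)
Definition rvec_measurable (Omega : Type) (R : realType) (d : nat)
    (S : set (set Omega)) (V : Omega -> 'rV[R]_d) : Prop :=
  forall D : set 'rV[R]_d, borel D -> S (V @^-1` D).

(* [S i] may be the full space, so that the product rule for the whole family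
   contains the product rule for its subfamilies. *)
Definition iid (dO dZ : measure_display) (Omega : measurableType dO)
    (Z : measurableType dZ) (R : realType) (P : probability Omega R)
    (m : nat) (zeta : 'I_m -> Omega -> Z) : Prop :=
  (forall (i j : 'I_m) (S : set Z), measurable S ->
     P (zeta i @^-1` S) = P (zeta j @^-1` S)) /\
  (forall S : 'I_m -> set Z, (forall i, measurable (S i)) ->
     P (\bigcap_i (zeta i @^-1` S i)) =
     \big[*%E/1%E]_(i < m) P (zeta i @^-1` S i)).

(* The sigma-algebra generated by the samples drawn before iteration [k]. *)
Definition past (dO dZ : measure_display) (Omega : measurableType dO)
    (Z : measurableType dZ) (m : nat) (zeta : nat -> 'I_m -> Omega -> Z)
    (k : nat) : set (set Omega) :=
  <<s [set D | exists (i : nat) (j : 'I_m) (S : set Z),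
         [/\ (i < k)%N, measurable S & D = zeta i j @^-1` S]] >>.

(* [Y] is a version of the conditional expectation of [X] given the
   sub-sigma-algebra [S].  Used for [X] nonnegative measurable or integrable:
   then a version exists and is almost surely unique; it is almost surely
   nonnegative in the first case and integrable in the second. *)
Definition is_condexp (dO : measure_display) (Omega : measurableType dO)
    (R : realType) (P : probability Omega R) (S : set (set Omega))
    (X Y : Omega -> \bar R) : Prop :=
  (forall D : set (\bar R), measurable D -> S (Y @^-1` D)) /\
  (forall D : set Omega, S D ->
     (\int[P]_(o in D) Y o = \int[P]_(o in D) X o)%E).

Definition condexp (dO : measure_display) (Omega : measurableType dO)
    (R : realType) (P : probability Omega R) (S : set (set Omega))
    (X : Omega -> \bar R) : Omega -> \bar R :=
  xget (cst 0%E) [set Y | is_condexp P S X Y].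

Definition condexp_vec (dO : measure_display) (Omega : measurableType dO)
    (R : realType) (P : probability Omega R) (S : set (set Omega))
    (d : nat) (V : Omega -> 'rV[R]_d) (o : Omega) : 'rV[R]_d :=
  \row_(i < d) fine (condexp P S (fun o' => (V o' 0 i)%:E) o).

Definition cond_moment (dO : measure_display) (Omega : measurableType dO)
    (R : realType) (P : probability Omega R) (S : set (set Omega))
    (d : nat) (r : nat) (V : Omega -> 'rV[R]_d) : Omega -> \bar R :=
  condexp P S (fun o => (enorm (V o) ^+ r)%:E).

Definition same_cond_law (dO : measure_display) (Omega : measurableType dO)
    (R : realType) (P : probability Omega R) (S : set (set Omega))
    (d : nat) (U V : Omega -> 'rV[R]_d) : Prop :=
  forall D : set 'rV[R]_d, borel D ->
    {ae P, forall o, condexp P S (fun o' => (\1_(U @^-1` D) o')%:E) o =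
                     condexp P S (fun o' => (\1_(V @^-1` D) o')%:E) o}.

(* A linear combination is encoded by the sequence [s] of its terms: the pair
   [(a, [:: r_1; ...; r_n])] stands for [a * M r_1 * ... * M r_n]. *)
Definition moment_combination (R : realType) (s : seq (R * seq nat))
    (M : nat -> \bar R) : \bar R :=
  (\sum_(t <- s) t.1%:E * \big[*%E/1%E]_(e <- t.2) M e)%E.

(* Main.v *)
(* By [L]-smoothness, [E_k F(w_(k+1))] is at most
   [F(w_k) - a_k <E_k A_k, grad F(w_k)> + L a_k^2 / 2 E_k |A_k|^2].  Resilience
   bounds the inner product from below, expected smoothness bounds the second
   moment, and [L B' a_k <= 1 - sin alpha] leaves half of the gradient term:
     delta_(k+1) + (1 - sin alpha) a_k / 2 E|grad F(w_k)|^2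
       <= (1 + L A' a_k^2) delta_k + L C' a_k^2 / 2
   with [delta_k = E F(w_k) - Flow].  Unrolling this bounds the smallest
   [E|grad F(w_k)|^2] through [prod_k (1 + L A' a_k^2) <= exp (L A' Q_K)].
   The exponential would give the wrong constant in the second bound: there
   [L A' a_k^2 = x b_k] with [x = A' / (L B'^2)] and [b_k] summable but of sum
   possibly larger than 1.  The product itself is at most [c e^x] uniformly in
   [x], because only the tail of [b_k] contributes exponentially. *)
Require Import Defs.
From HB Require Import structures.
From mathcomp Require Import all_boot all_order all_algebra.
From mathcomp Require Import all_classical all_reals all_analysis measurable_realfun.
From mathcomp Require Import lra ring.
Import Order.TTheory GRing.Theory Num.Theory.
Import numFieldNormedType.Exports.
Local Open Scope classical_set_scope.
Local Open Scope ring_scope.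

(** * Real sequences *)

(** Integral comparison: with $r = 2p-1$, the function $t^{-r}/r$, written through [expR] and [ln],
    is minus a primitive of $t^{-2p}$. In place of an integral, the proof combines $\ln(n+1)-\ln n
    \ge 1/(n+1)$ with $e^u \ge 1+u$. *)
Lemma inv_powR_le_telescope (R : realType) (p : R) (n : nat) : 1 / 2 < p -> (0 < n)%N ->
  ((n.+1%:R `^ p) ^+ 2)^-1 <=
  (expR (- ((2 * p - 1) * ln n%:R)) - expR (- ((2 * p - 1) * ln n.+1%:R)))
    / (2 * p - 1).
Proof.
move=> hp n0; set r := 2 * p - 1; have r0 : 0 < r by rewrite /r; lra.
have y0 : 0 < n.+1%:R :> R by rewrite ltr0n.
have x0 : 0 < n%:R :> R by rewrite ltr0n.
have -> : ((n.+1%:R `^ p) ^+ 2)^-1 = expR (- (r * ln n.+1%:R)) * n.+1%:R^-1 :> R.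
  rewrite -{3}(lnK y0) -expRN -expRD /powR gt_eqF// -expRM_natl -expRN.
  by congr expR; rewrite /r; ring.
rewrite ler_pdivlMr//.
have -> : expR (- (r * ln n%:R)) =
  expR (- (r * ln n.+1%:R)) * expR (r * (ln n.+1%:R - ln n%:R)) :> R.
  by rewrite -expRD; congr expR; ring.
rewrite -[X in _ - X]mulr1 -mulrBr -mulrA ler_pM2l ?expR_gt0//.
have hln : n.+1%:R^-1 <= ln n.+1%:R - ln n%:R :> R.
  (* Since $n = (n+1)(1 - 1/(n+1))$, the claim follows from $\ln(1+t) \le t$ at $t = -1/(n+1)$. *)
  have -> : ln n%:R = ln n.+1%:R + ln (1 + - n.+1%:R^-1) :> R.
    rewrite -lnM ?posrE//.
      by congr ln; rewrite mulrDr mulr1 mulrN divff ?gt_eqF// -natr1 addrK.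
    by rewrite subr_gt0 invf_lt1// ltr1n.
  have := @le_ln1Dx R (- n.+1%:R^-1).
  rewrite ltrN2 invf_lt1// ltr1n ltnS n0 => /(_ isT).
  by rewrite opprD addrA subrr add0r lerNr.
rewrite lerBrDr addrC; apply: le_trans (expR_ge1Dx _).
by rewrite lerD2l mulrC ler_pM2l.
Qed.

(** The value $1/2$ is the one [prod_1D_le_expR] uses: the tail may consume only half of the
    exponent $x$. *)
Lemma inv_powR_summable (R : realType) (p : R) : 1 / 2 < p ->
  exists J : nat, (0 < J)%N /\
    forall K, \sum_(J <= k < K) ((k.+1%:R `^ p) ^+ 2)^-1 <= 1 / 2 :> R.
Proof.
move=> hp; have r0 : 0 < 2 * p - 1 by lra.
set r := 2 * p - 1 in r0 *.
(* The telescoped tail is at most $J^{-r}/r$, which is below $1/2$ once $J > (r/2)^{-1/r}$. *)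
pose J := (Num.trunc (expR (- ln (r / 2) / r))).+1.
have HJ : expR (- ln (r / 2) / r) < J%:R := truncnS_gt _.
exists J; split=> // K.
case: (leqP J K) => JK; last by rewrite big_geq ?(ltnW JK)//; lra.
apply: (@le_trans _ _ (\sum_(J <= k < K)
    ((- (expR (- (r * ln k.+1%:R)) / r)) - (- (expR (- (r * ln k%:R)) / r))))).
  rewrite big_nat_cond [leRHS]big_nat_cond; apply: ler_sum => k /andP[/andP[Jk _] _].
  by rewrite opprK addrC -mulrBl inv_powR_le_telescope// (leq_trans _ Jk).
rewrite (telescope_sumr (fun k => - (expR (- (r * ln k%:R)) / r)))//.
have h0 : 0 <= expR (- (r * ln K%:R)) / r by rewrite divr_ge0 ?expR_ge0 ?ltW.
suff : expR (- (r * ln J%:R)) / r <= 1 / 2 by lra.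
have hJ : - ln (r / 2) / r < ln J%:R.
  by rewrite -ltr_expR lnK// posrE ltr0n.
have -> : 1 / 2 = r / 2 / r by field; rewrite gt_eqF.
rewrite ler_pM2r ?invr_gt0// -[leRHS]lnK ?posrE; last by lra.
by rewrite ler_expR lerNl [_ * ln _]mulrC -ler_pdivrMr// ltW.
Qed.

(* The growth of the product is of smaller order than [expR (x * sum a)] in [x]:
   only the tail of the series matters, the first [J] factors being polynomial. *)
Lemma prod_1D_le_expR (R : realType) (a : nat -> R) (J : nat) (x : R) :
  (0 < J)%N -> (forall k, 0 <= a k <= 1) ->
  (forall K, \sum_(J <= k < K) a k <= 1 / 2) -> 0 <= x ->
  forall K, \prod_(k < K) (1 + x * a k) <= (2 * J%:R) ^+ J * expR x.
Proof.
move=> J0 ha htail x0 K.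
have x1 : 1 <= 1 + x by rewrite lerDl.
(* The first $J$ factors are bounded by $1+x$, the others by $e^{x a_k}$. *)
apply: (@le_trans _ _ ((1 + x) ^+ minn K J * expR (x * \sum_(J <= k < K) a k))).
  elim: K => [|K IH]; first by rewrite big_ord0 min0n big_geq// mulr0 expR0 mulr1.
  have /andP[a0 a1] := ha K.
  have c0 : 0 <= 1 + x * a K by rewrite addr_ge0// mulr_ge0.
  rewrite big_ord_recr /=; apply: le_trans (ler_wpM2r c0 IH) _.
  case: (ltnP K J) => KJ.
    rewrite ?(minn_idPl KJ) ?(minn_idPl (ltnW KJ)) !big_geq// ?(ltnW KJ)// exprSr.
    rewrite mulr0 expR0 !mulr1 ler_wpM2l ?exprn_ge0 ?(le_trans ler01)//.
    by rewrite lerD2l ler_piMr.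
  rewrite ?(minn_idPr KJ) ?(minn_idPr (leqW KJ)) big_nat_recr//= -mulrA.
  rewrite ler_wpM2l ?exprn_ge0 ?(le_trans ler01)// [x * (_ + _)]mulrDr expRD.
  by rewrite ler_wpM2l ?expR_ge0// expR_ge1Dx.
(* One half of the exponent pays for the tail, the other for $(1+x)^J$. *)
have -> : expR x = expR (x / 2) * expR (x / 2) by rewrite -expRD; congr expR; field.
rewrite mulrA; apply: ler_pM; rewrite ?exprn_ge0 ?expR_ge0 ?(le_trans ler01)//; last first.
  by rewrite ler_expR ler_wpM2l//; have := htail K; lra.
apply: (@le_trans _ _ ((1 + x) ^+ J)).
  by rewrite ler_weXn2l// geq_minr.
have Jp : 0 < J%:R :> R by rewrite ltr0n.
have -> : expR (x / 2) = expR (x / (2 * J%:R)) ^+ J.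
  by rewrite -expRM_natl; congr expR; field; rewrite gt_eqF.
rewrite -exprMn lerXn2r ?nnegrE ?addr_ge0 ?mulr_ge0 ?expR_ge0 ?ler0n//.
(* Here $1+x \le 2J + x = 2J(1 + x/(2J)) \le 2J\, e^{x/(2J)}$, whose $J$-th power is $(2J)^J
   e^{x/2}$. *)
apply: (@le_trans _ _ (2 * J%:R * (1 + x / (2 * J%:R)))); last first.
  by rewrite ler_wpM2l ?mulr_ge0 ?ler0n ?expR_ge1Dx.
rewrite mulrDr mulr1 mulrCA divff ?mulr1; last by rewrite gt_eqF// mulr_gt0.
by rewrite lerD2r -natrM ler1n muln_gt0.
Qed.

(** Induction on $K$: multiplying the previous bound by $1+u_K \ge 1$ only enlarges the sum already
    accumulated on the left. The product is not replaced by an exponential, because the two final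
    bounds estimate it differently. *)
Lemma gronwall_sum (R : realType) (dl G u v e : nat -> R) (K : nat) :
  (forall k, 0 <= dl k) -> (forall k, 0 <= v k) -> (forall k, 0 <= u k) ->
  (forall k, 0 <= e k * G k) ->
  (forall k, dl k.+1 + e k * G k <= (1 + u k) * dl k + v k) ->
  dl K + \sum_(k < K) e k * G k <=
  \prod_(k < K) (1 + u k) * (dl 0%N + \sum_(k < K) v k).
Proof.
move=> d0 v0 u0 eG0 hrec; elim: K => [|K IH]; first by rewrite !big_ord0 mul1r.
rewrite !big_ord_recr /=.
set S := \sum_(k < K) _ in IH *; set T := \sum_(k < K) v k in IH *.
set Pr := \prod_(k < K) _ in IH *.
have S0 : 0 <= S by apply: sumr_ge0.
have T0 : 0 <= T by apply: sumr_ge0.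
have P1 : 1 <= Pr by rewrite /Pr; elim/big_ind: _ => // [a b|i _]; [exact: mulr_ege1|rewrite lerDl].
have := ler_wpM2l (_ : 0 <= 1 + u K) IH; rewrite addr_ge0// => /(_ isT).
have vP : v K <= Pr * (1 + u K) * v K.
  by rewrite ler_peMl// mulr_ege1// lerDl.
have uS : 0 <= u K * S by rewrite mulr_ge0.
have := hrec K; lra.
Qed.

(** * Euclidean geometry and the descent lemma *)

Section inner_product.
Context {R : realType} {d : nat}.
Implicit Types u v w : 'rV[R]_d.

Lemma innerC u v : inner u v = inner v u.
Proof. by apply: eq_bigr => i _; rewrite mulrC. Qed.

Lemma innerDr u v w : inner u (v + w) = inner u v + inner u w.
Proof. by rewrite /inner -big_split; apply: eq_bigr => i _; rewrite mxE mulrDr. Qed.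

Lemma innerZr (t : R) u v : inner u (t *: v) = t * inner u v.
Proof. by rewrite /inner mulr_sumr; apply: eq_bigr => i _; rewrite mxE mulrCA. Qed.

Lemma innerDl u v w : inner (u + v) w = inner u w + inner v w.
Proof. by rewrite innerC innerDr !(innerC w). Qed.

Lemma innerZl (t : R) u v : inner (t *: u) v = t * inner u v.
Proof. by rewrite innerC innerZr innerC. Qed.

Lemma innerNr u v : inner u (- v) = - inner u v.
Proof. by rewrite -scaleN1r innerZr mulN1r. Qed.

Lemma innerNl u v : inner (- u) v = - inner u v.
Proof. by rewrite -scaleN1r innerZl mulN1r. Qed.

Lemma inner_ge0 u : 0 <= inner u u.
Proof. by apply: sumr_ge0 => i _; exact: sqr_ge0. Qed.

Lemma enorm_ge0 u : 0 <= enorm u.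
Proof. exact: sqrtr_ge0. Qed.

Lemma enorm_sqr u : enorm u ^+ 2 = inner u u.
Proof. by rewrite sqr_sqrtr ?inner_ge0. Qed.

Lemma enormZ (t : R) u : enorm (t *: u) = `|t| * enorm u.
Proof. by rewrite /enorm innerZl innerZr mulrA -expr2 sqrtrM ?sqr_ge0// sqrtr_sqr. Qed.

Lemma enormN u : enorm (- u) = enorm u.
Proof. by rewrite -scaleN1r enormZ normrN1 mul1r. Qed.

Lemma inner_le_sum_sqr u v : inner u v <= (enorm u ^+ 2 + enorm v ^+ 2) / 2.
Proof.
have := inner_ge0 (u - v).
rewrite innerDl !innerDr !innerNl !innerNr (innerC v u) -!enorm_sqr.
lra.
Qed.

Lemma normr_inner_le u v : `|inner u v| <= (enorm u ^+ 2 + enorm v ^+ 2) / 2.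
Proof.
by rewrite ler_norml lerNl -innerNl -{1}(enormN u) !inner_le_sum_sqr.
Qed.

(** From $|t| \le t^2+1$. It dominates a coordinate by the squared norm, so a finite second moment
    makes the coordinates integrable. *)
Lemma normr_coord_le u i : `|u 0 i| <= enorm u ^+ 2 + 1.
Proof.
have h : u 0 i ^+ 2 <= enorm u ^+ 2.
  rewrite enorm_sqr /inner (bigD1 i)//= -expr2 lerDl.
  by apply: sumr_ge0 => j _; exact: sqr_ge0.
apply: le_trans (_ : `|u 0 i| ^+ 2 + 1 <= _); last by rewrite real_normK ?num_real// lerD2r.
have : 0 <= (`|u 0 i| - 1) ^+ 2 by exact: sqr_ge0.
by have := normr_ge0 (u 0 i); move: `|_| => a; lra.
Qed.

Lemma inner_eq0l u v : enorm u = 0 -> inner u v = 0.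
Proof.
move=> /(congr1 (fun t => t ^+ 2)); rewrite enorm_sqr expr0n /= => u0.
have /psumr_eq0P h : forall i : 'I_d, true -> 0 <= u 0 i * u 0 i.
  by move=> i _; exact: sqr_ge0.
apply: big1 => i _; have /eqP := h u0 i isT.
by rewrite mulf_eq0 orbb => /eqP ->; rewrite mul0r.
Qed.

(** Cauchy-Schwarz: with $a=\|u\|$ and $b=\|v\|$, expanding $\|bu-av\|^2 \ge 0$ gives
    $2ab(ab-\langle u,v\rangle) \ge 0$, and $ab$ is cancelled when it is positive. *)
Lemma inner_le_enorm u v : inner u v <= enorm u * enorm v.
Proof.
have [U0|U0] := eqVneq (enorm u) 0; first by rewrite inner_eq0l// U0 mul0r.
have [V0|V0] := eqVneq (enorm v) 0; first by rewrite innerC inner_eq0l// V0 mulr0.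
have UV : 0 < enorm u * enorm v by rewrite mulr_gt0// lt_def enorm_ge0 andbT.
rewrite -subr_ge0 -(pmulr_rge0 _ UV).
have := inner_ge0 (enorm v *: u - enorm u *: v).
rewrite innerDl !innerDr !innerNl !innerNr !innerZl !innerZr (innerC v u) -!enorm_sqr.
by move: (enorm u) (enorm v) (inner u v) => a b c; lra.
Qed.
End inner_product.

Section descent.
Context {R : realType} {d : nat}.
Implicit Types (F : 'rV[R]_d -> R) (u v : 'rV[R]_d).

Lemma derive_grad F u v : differentiable F u -> 'D_v F u = inner (grad F u) v.
Proof.
move=> dF; rewrite deriveE// {1}(row_sum_delta v) linear_sum; apply: eq_bigr => i _.
by rewrite linearZ /= !mxE deriveE// mulrC.
Qed.

Lemma is_derive_line F u v (t : R) : differentiable F (u + t *: v) ->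
  is_derive t 1 (fun s : R => F (u + s *: v)) (inner (grad F (u + t *: v)) v).
Proof.
move=> dF.
have E : (fun h : R => h^-1 *: (((fun s : R => F (u + s *: v)) \o shift t) (h *: 1)
            - F (u + t *: v))) =
         (fun h : R => h^-1 *: ((F \o shift (u + t *: v)) (h *: v) - F (u + t *: v))).
  apply/funext => h /=; congr (_ *: (F _ - _)).
  by rewrite /shift /= -[h *: 1]/(h * 1) mulr1 scalerDl addrCA.
have dF' : derivable F (u + t *: v) v by exact: diff_derivable.
apply: DeriveDef; first by rewrite /derivable E.
by rewrite -derive_grad// /derive E.
Qed.

(** Monotonicity replaces integration. Along the segment from $u$ to $v$, [psi] is $F$ minus its
    quadratic upper model up to a constant; its derivative $\langle\nabla F(u+tw)-\nabla
    F(u),w\rangle - Lt\|w\|^2$ is nonpositive by Cauchy-Schwarz and the Lipschitz bound. *)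
Lemma descent_lemma F (L : R) u v : (forall w, differentiable F w) ->
  (forall u v, enorm (grad F u - grad F v) <= L * enorm (u - v)) ->
  F v <= F u + inner (grad F u) (v - u) + L / 2 * enorm (v - u) ^+ 2.
Proof.
move=> dF lipF; set w := v - u; set c := inner (grad F u) w; set N := enorm w ^+ 2.
pose psi (t : R) := F (u + t *: w) - (c * t + L / 2 * N * t ^+ 2).
have dpsi (t : R) : is_derive t 1 psi
    (inner (grad F (u + t *: w)) w - (c + L * N * t)).
  have h1 := is_derive_line F u w t (dF _).
  have h2 : is_derive t (1 : R) (fun s : R => c * s + L / 2 * N * s ^+ 2) (c + L * N * t).
    apply: is_derive_eq.
    by rewrite /GRing.scale /= !mulr1; field.
  exact: (is_deriveB h1 h2).
have Dpsi (t : R) : derivable psi t 1 by have [] := dpsi t.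
have le01psi : psi 1 <= psi 0.
  apply: (@ler0_derive1_le_cc R psi 0 1) => //.
  - move=> t; rewrite in_itv /= => /andP[t0 t1].
    rewrite derive1E derive_val subr_le0 -lerBlDl.
    rewrite /c -innerNl -innerDl; apply: le_trans (inner_le_enorm _ _) _.
    apply: le_trans (ler_wpM2r (enorm_ge0 _) (lipF _ _)) _.
    by rewrite addrAC subrr add0r enormZ gtr0_norm// /N; lra.
  - apply: derivable_within_continuous => t _; exact: Dpsi.
  - by rewrite in_itv /= lexx ler01.
  - by rewrite in_itv /= lexx ler01.
have wE : u + w = v by rewrite /w addrCA subrr addr0.
by move: le01psi; rewrite /psi scale1r scale0r addr0 wE expr1n expr0n /=; lra.
Qed.

(** The descent lemma at the gradient step $u-\nabla F(u)/L$, where $F$ is still at least [Flow]. It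
    makes the squared gradient integrable as soon as $F(w_k)-F_{\text{low}}$ is. *)
Lemma grad_sqr_le F (L Flow : R) u : 0 < L -> (forall w, differentiable F w) ->
  (forall u v, enorm (grad F u - grad F v) <= L * enorm (u - v)) ->
  (forall v, Flow <= F v) ->
  enorm (grad F u) ^+ 2 <= 2 * L * (F u - Flow).
Proof.
move=> L0 dF lipF Flow_le.
have := descent_lemma F L u (u - L^-1 *: grad F u) dF lipF.
have -> : u - L^-1 *: grad F u - u = - (L^-1 *: grad F u) by rewrite addrAC subrr add0r.
rewrite innerNr innerZr -enorm_sqr enormN enormZ exprMn.
rewrite real_normK ?num_real//; have := Flow_le (u - L^-1 *: grad F u).
set N := enorm _ ^+ 2; move: (F _) => Fv h1 h2.
have -> : N = 2 * L * (L^-1 * N - L / 2 * (L^-1 ^+ 2 * N)) by field; rewrite gt_eqF.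
by rewrite ler_pM2l ?mulr_gt0//; lra.
Qed.

Lemma grad_mean (m : nat) (Fi : 'I_m -> 'rV[R]_d -> R) F u :
  (forall w, F w = m%:R^-1 * \sum_(i < m) Fi i w) ->
  (forall i w, differentiable (Fi i) w) ->
  differentiable F u /\ grad F u = m%:R^-1 *: \sum_(i < m) grad (Fi i) u.
Proof.
move=> hF dFi; have -> : F = m%:R^-1 \*: (\sum_(i < m) Fi i).
  by apply/funext => w; rewrite hF /= fct_sumE.
have dS w : differentiable (\sum_(i < m) Fi i) w by exact: differentiable_sum.
split; first exact: differentiableZ.
apply/rowP => j; rewrite !mxE summxE deriveZ ?derive_sum//.
- by congr (_ * _); apply: eq_bigr => i _; rewrite mxE.
- by move=> i; exact: diff_derivable.
- exact: diff_derivable.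
Qed.
End descent.

(** * Conditional expectation *)

Section real_integrals.
Context {dT : measure_display} {T : measurableType dT} {R : realType}.
Context {mu : {measure set T -> \bar R}}.
Implicit Types f g : T -> R.
Local Notation intg f := (mu.-integrable setT (EFin \o f)).

Lemma integrable_EFin_measurable f : intg f -> measurable_fun setT f.
Proof. by move=> /measurable_int /measurable_EFinP. Qed.

Lemma integrable_EFinD f g : intg f -> intg g -> intg (fun x => f x + g x).
Proof.
move=> If Ig; apply: (eq_integrable measurableT ((EFin \o f) \+ (EFin \o g))%E) => //.
exact: integrableD.
Qed.

Lemma integrable_EFinZ (k : R) f : intg f -> intg (fun x => k * f x).
Proof.
move=> If; apply: (eq_integrable measurableT (fun x => k%:E * (EFin \o f) x)%E) => //.
exact: integrableZl.
Qed.

Lemma integrable_EFinB f g : intg f -> intg g -> intg (fun x => f x - g x).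
Proof.
move=> If Ig; apply: (eq_integrable measurableT ((EFin \o f) \- (EFin \o g))%E) => //.
exact: integrableB.
Qed.

Lemma integrable_EFin_sum n (f : 'I_n -> T -> R) : (forall i, intg (f i)) ->
  intg (fun x => \sum_(i < n) f i x).
Proof.
move=> If; apply: (eq_integrable measurableT (fun x => \sum_(i < n) (EFin \o f i) x)%E).
  by move=> x _ /=; rewrite sumEFin.
by apply: integrable_sum => // i _; exact: If.
Qed.

Lemma Rintegral_sum n (f : 'I_n -> T -> R) : (forall i, intg (f i)) ->
  \int[mu]_x (\sum_(i < n) f i x) = \sum_(i < n) \int[mu]_x f i x.
Proof.
move=> If; elim: n f If => [|n IH] f If.
  rewrite big_ord0; under eq_Rintegral do rewrite big_ord0.
  by rewrite /Rintegral integral0.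
rewrite big_ord_recr /= -IH; last by move=> i; exact: If.
rewrite -RintegralD//.
  by apply: eq_Rintegral => x _; rewrite big_ord_recr.
by apply: integrable_EFin_sum => i; exact: If.
Qed.

Lemma integrable_dominated f g : measurable_fun setT f -> intg g ->
  (forall x, `|f x| <= g x) -> intg f.
Proof.
move=> mf Ig fg; apply: (le_integrable measurableT _ _ Ig); first exact/measurable_EFinP.
by move=> x _; rewrite /= lee_fin (le_trans (fg x))// ler_norm.
Qed.

Lemma integrable_bounded_mul (M : R) f g : measurable_fun setT f -> (forall x, `|f x| <= M) ->
  intg g -> intg (fun x => f x * g x).
Proof.
move=> mf fM Ig.
apply: (integrable_dominated _ (fun x => M * `|g x|)).
- by apply: measurable_funM => //; apply: measurableT_comp => //; exact: integrable_EFin_measurable.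
- by apply: integrable_EFinZ; exact: integrable_norm.
- by move=> x; rewrite normrM ler_wpM2r.
Qed.

Lemma ae_le_Rintegral f g : intg f -> intg g -> {ae mu, forall x, f x <= g x} ->
  \int[mu]_x f x <= \int[mu]_x g x.
Proof.
move=> If Ig fg.
have mf := integrable_EFin_measurable f If; have mg := integrable_EFin_measurable g Ig.
have mm : measurable_fun setT (fun x => Num.min (f x) (g x)) by exact: measurable_minr.
(* The minimum equals $f$ almost everywhere and lies below $g$ everywhere. *)
have -> : \int[mu]_x f x = \int[mu]_x Num.min (f x) (g x).
  congr fine; apply: ae_eq_integral => //; [exact/measurable_EFinP..|].
  by apply: filterS fg => x fgx _ /=; rewrite (min_idPl fgx).
apply: le_Rintegral => //.
  apply: (integrable_dominated _ (fun x => `|f x| + `|g x|)) => //.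
    by apply: integrable_EFinD; exact: integrable_norm.
  by move=> x; rewrite minEle; case: ifP => _; rewrite ?lerDl ?lerDr.
by move=> x _; rewrite ge_min lexx orbT.
Qed.

End real_integrals.

(** * Existence of conditional expectations *)

Section condexp_existence.
Context {dO : measure_display} {Omega : measurableType dO} {R : realType}.
Context (P : probability Omega R) (Gen : set (set Omega)).
Hypothesis hS : <<s Gen >> `<=` measurable.
Local Open Scope ereal_scope.

(** [T] is [Omega] with the smaller sigma-algebra and [phi] the identity as a measurable map onto
    it: pushing a measure forward along [phi] restricts it to [<<s Gen>>]. *)
Let T : measurableType _ := g_sigma_algebraType Gen.
Let phi : Omega -> T := id.

Let mphi : measurable_fun setT phi.
Proof. by move=> _ D mD; rewrite setTI; exact: hS. Qed.

Lemma sub_measurable_fun d' (T' : measurableType d') (f : T -> T') :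
  measurable_fun setT f -> measurable_fun setT (fun o : Omega => f o).
Proof.
move=> mf _ D mD; rewrite setTI; apply: hS.
by have := mf measurableT D mD; rewrite setTI.
Qed.

Let rphi : {mfun Omega >-> T} := HB.pack phi (isMeasurableFun.Build _ _ _ _ phi mphi).

(** The version is the Radon-Nikodym derivative of the charge $D \mapsto \int_D X\,dP$ with respect
    to $P$, both restricted to [<<s Gen>>]. *)
Lemma integrable_condexp_exists (X : Omega -> \bar R) : P.-integrable setT X ->
  exists Y, is_condexp P <<s Gen >> X Y.
Proof.
move=> iX.
pose nu : {charge set T -> \bar R} :=
  measure_function_pushforward__canonical__charge_Charge (induced_charge iX) mphi.
pose mu : probability T R := distribution P rphi.
have numu : nu `<< mu.
  apply: (@dominates_pushforward _ _ Omega T R P (induced_charge iX) phi mphi).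
  apply/null_content_dominatesP => A mA PA; apply: null_set_integral => //.
  exact: measurable_funTS (measurable_int _ iX).
pose Y := Radon_Nikodym nu mu.
have iY : mu.-integrable setT Y by exact: Radon_Nikodym_integrable.
have mY : measurable_fun [set: T] Y by exact: measurable_int iY.
exists (Y \o phi); split=> [D mD|D mD].
  by have := mY measurableT D mD; rewrite setTI.
have -> : \int[P]_(o in D) X o = nu D by [].
rewrite (@Radon_Nikodym_integral _ T R nu mu D numu mD).
have iYP : P.-integrable setT (Y \o phi).
  apply/integrableP; split; first exact: measurableT_comp.
  have /integrableP[_] := iY; rewrite /mu /distribution ge0_integral_pushforward//.
  exact: measurableT_comp.
rewrite /mu /distribution integral_pushforward//.
by apply: (integrableS measurableT _ _ iYP) => //; exact: hS.
Qed.

Lemma condexp_measurable_sub (X Y : Omega -> \bar R) :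
  is_condexp P <<s Gen >> X Y -> measurable_fun [set: T] (Y : T -> \bar R).
Proof. by move=> [mY _] _ D mD; rewrite setTI; exact: mY. Qed.

Lemma condexp_measurable (X Y : Omega -> \bar R) :
  is_condexp P <<s Gen >> X Y -> measurable_fun setT Y.
Proof. by move=> [mY _] _ D mD; rewrite setTI; apply: hS; exact: mY. Qed.

(** The event $\{Y<0\}$ lies in the sub-sigma-algebra, and on it $\int|Y| = -\int Y = -\int X \le
    0$. *)
Lemma condexp_ge0_ae (X Y : Omega -> \bar R) : (forall o, 0 <= X o) ->
  is_condexp P <<s Gen >> X Y -> {ae P, forall o, 0 <= Y o}.
Proof.
move=> X0 cY; have mY := condexp_measurable X Y cY; case: cY => [SY YX].
pose D := Y @^-1` `]-oo, 0[%classic.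
have SD : <<s Gen >> D by apply: SY; exact: emeasurable_itv.
have mD : measurable D := hS _ SD.
have Yneg o : D o -> Y o < 0 by rewrite /D /= in_itv.
have intY0 : \int[P]_(o in D) `|Y o| = 0.
  apply/eqP; rewrite eq_le integral_ge0// andbT.
  have -> : \int[P]_(o in D) `|Y o| = - \int[P]_(o in D) Y o.
    rewrite -[LHS]oppeK -integral_ge0N//; congr (- _).
    apply: eq_integral => o; rewrite inE => /Yneg Yo.
    by rewrite lte0_abs// oppeK.
  by rewrite YX// oppe_le0 integral_ge0.
have /(ae_eq_integral_abs P mD (measurable_funTS mY)) := intY0.
apply: filterS => o /= h; rewrite leNgt; apply/negP => Yo.
have Do : D o by rewrite /D /= in_itv.
by move: Yo; rewrite h// ltxx.
Qed.

(** Taking the positive part makes a version nonnegative everywhere, as required for summing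
    countably many versions below. *)
Lemma ge0_integrable_condexp_exists (X : Omega -> \bar R) :
  (forall o, 0 <= X o) -> P.-integrable setT X ->
  exists2 Y, forall o, 0 <= Y o & is_condexp P <<s Gen >> X Y.
Proof.
move=> X0 iX; have [Y cY] := integrable_condexp_exists X iX.
exists Y^\+; first by move=> o; exact: funepos_ge0.
have mYT := condexp_measurable_sub X Y cY.
have mY := condexp_measurable X Y cY; have Y0 := condexp_ge0_ae X Y X0 cY.
split=> [D mD|D SD].
  by have := @measurable_funepos _ T R setT Y mYT measurableT D mD; rewrite setTI.
case: cY => _ /(_ D SD) <-.
apply: ae_eq_integral; first exact: hS.
- by apply: measurable_funepos; exact: measurable_funTS.
- exact: measurable_funTS.
- apply: filterS Y0 => o Yo _; rewrite funeposE.
  by apply/max_idPl.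
Qed.

(* Radon-Nikodym needs a finite measure, hence the cut into the slices
   [{n <= X < n + 1}]: [X] may have an infinite integral. *)
Lemma ge0_condexp_exists (X : Omega -> R) : measurable_fun setT X ->
  (forall o, (0 <= X o)%R) -> exists Y, is_condexp P <<s Gen >> (EFin \o X) Y.
Proof.
move=> mX X0; pose A n := X @^-1` `[n%:R, n.+1%:R[%classic.
have mA n : measurable (A n) by rewrite -[A n]setTI; exact: mX.
have tA : trivIset setT A.
  apply/trivIsetP => i j _ _; wlog ij : i j / (i < j)%N.
    by move=> H; rewrite neq_ltn => /orP[] h; [|rewrite setIC]; apply: H => //; rewrite lt_eqF.
  move=> _; rewrite -subset0 => o []; rewrite /A /= !in_itv /= => /andP[_ a] /andP[b _].
  have := le_lt_trans b a; rewrite ltr_nat ltnS => ji.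
  by move: (leq_trans ij ji); rewrite ltnn.
have UA : \bigcup_n A n = setT.
  apply/seteqP; split=> // o _; exists (Num.trunc (X o)) => //.
  by rewrite /A /= in_itv /= truncn_itv.
have mXA n : measurable_fun setT ((EFin \o X) \_ (A n)).
  apply/measurable_restrict => //; rewrite ?setTI//.
  by apply/measurable_EFinP; exact: measurable_funTS.
have hn n : exists2 Y, forall o, 0 <= Y o & is_condexp P <<s Gen >> ((EFin \o X) \_ (A n)) Y.
  apply: ge0_integrable_condexp_exists.
    by move=> o; rewrite patchE; case: ifP => // _; rewrite lee_fin.
  apply: (@le_integrable _ _ _ P setT measurableT _ (cst n.+1%:R%:E)) => //.
    move=> o _; rewrite patchE; case: ifPn => [|_]; last by rewrite abse0.
    rewrite inE /A /= in_itv /= => /andP[_ h].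
    by rewrite lee_fin !ger0_norm// ltW.
  exact: finite_measure_integrable_cst.
pose Y n := sval (cid2 (hn n)).
have Y0 n o : 0 <= Y n o by rewrite /Y; case: cid2.
have cY n : is_condexp P <<s Gen >> ((EFin \o X) \_ (A n)) (Y n) by rewrite /Y; case: cid2.
(* The versions of the slices are summed; nonnegativity allows exchanging sum and integral, and the
   slices partition the space. *)
have mYT n := condexp_measurable_sub _ _ (cY n).
exists (fun o => \sum_(n <oo) Y n o); split=> [D mD|D SD].
  have := @ge0_emeasurable_sum _ T R setT (fun n o => Y n o) xpredT
    (fun n o _ _ => Y0 n o) (fun n _ => mYT n) measurableT D mD.
  by rewrite setTI.
have mD := hS _ SD.
rewrite integral_nneseries//; last first.
  by move=> n; apply: measurable_funTS; exact: condexp_measurable (cY n).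
rewrite -{2}(setIT D) -UA setI_bigcupr ge0_integral_bigcup//.
- by apply: eq_eseriesr => n _; case: (cY n) => _ ->//; rewrite integral_mkcondr.
- by move=> n; exact: measurableI.
- by apply: measurable_funTS; exact/measurable_EFinP.
- by move=> o _; rewrite lee_fin.
- exact: trivIset_setIl.
Qed.

(** * Integrals against functions measurable for the sub-sigma-algebra *)

Import HBNNSimple.

(** The right-hand side sees [W] only through its integrals over sets of [<<s Gen>>], which are the
    quantities a conditional expectation preserves. *)
Lemma integral_simpleM (g : {nnsfun T >-> R}) (W : Omega -> R) :
  measurable_fun setT W -> (forall o, (0 <= W o)%R) ->
  \int[P]_o (g (phi o) * W o)%:E =
  \sum_(r \in range g) r%:E * \int[P]_(o in g @^-1` [set r]) (W o)%:E.
Proof.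
move=> mW W0.
have mg r : measurable (g @^-1` [set r] : set Omega).
  by apply: hS; exact: (measurable_sfunP g (measurable_set1 r)).
have mr r : measurable_fun setT (fun o : Omega => (r * \1_(g @^-1` [set r]) o * W o)%:E).
  by apply/measurable_EFinP; apply: measurable_funM => //; exact: measurable_funM.
have r0 r o : (0 <= (r * \1_(g @^-1` [set r]) o)%R)%R.
  by rewrite -lee_fin; exact: nnfun_muleindic_ge0.
transitivity (\int[P]_o (\sum_(r \in range g) (r * \1_(g @^-1` [set r]) o * W o)%:E)).
  apply: eq_integral => o _; rewrite fsumEFin// (fimfunE g (phi o)) mulr_fsuml//.
rewrite ge0_integral_fsum//; last by move=> r o _; rewrite lee_fin mulr_ge0.
apply: eq_fsbigr => r; rewrite inE => -[t _ gt].
under eq_integral do rewrite -mulrA EFinM.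
rewrite ge0_integralZl//.
- congr (_ * _); rewrite -[in RHS](setTI (_ @^-1` _)) integral_mkcondr.
  by apply: eq_integral => o _; rewrite patchE /= indicE; case: ifP => _; rewrite ?mul1r ?mul0r.
- by apply/measurable_EFinP; exact: measurable_funM.
- by move=> o _; rewrite lee_fin mulr_ge0.
- by rewrite lee_fin -gt.
Qed.

(** Monotone convergence extends [integral_simpleM] from simple functions to nonnegative ones; again
    [W] enters only through its integrals over sets of [<<s Gen>>]. *)
Lemma ge0_integralM_lim (h : T -> R) (mh : measurable_fun setT (EFin \o h)) (W : Omega -> R) :
  (forall t, (0 <= h t)%R) ->
  measurable_fun setT W -> (forall o, (0 <= W o)%R) ->
  \int[P]_o (h (phi o) * W o)%:E =
  limn (fun n => let g := nnsfun_approx measurableT mh n in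
    \sum_(r \in range g) r%:E * \int[P]_(o in g @^-1` [set r]) (W o)%:E).
Proof.
move=> h0 mW W0; transitivity (limn (fun n =>
    \int[P]_o (nnsfun_approx measurableT mh n (phi o) * W o)%:E)); last first.
  by congr (lim (_ @ \oo)); apply/funext => n; exact: integral_simpleM.
rewrite -monotone_convergence//.
- apply: eq_integral => o _; apply/esym/cvg_lim => //.
  under eq_fun do rewrite EFinM.
  rewrite EFinM; apply: cvgeZr => //.
  by apply: (@cvg_nnsfun_approx _ T R setT measurableT _ mh) => // t _; rewrite lee_fin.
- move=> n; apply/measurable_EFinP; apply: measurable_funM => //.
  by apply: (sub_measurable_fun _ _ (nnsfun_approx measurableT mh n)).
- by move=> n o _; rewrite lee_fin mulr_ge0.
- move=> o _ a b ab; rewrite lee_fin ler_wpM2r//.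
  exact/lefP/nd_nnsfun_approx.
Qed.

(** The pull-out property in integrated form. For nonnegative factors, [ge0_integralM_lim] writes
    both sides as the same limit; the rest reduces to that case. *)
Lemma Rintegral_bounded_mul_eq (M : R) (h : T -> R) (X y : Omega -> R) :
  measurable_fun setT h -> (forall t, (`|h t| <= M)%R) ->
  P.-integrable setT (EFin \o X) -> P.-integrable setT (EFin \o y) ->
  (forall D, <<s Gen >> D -> \int[P]_(o in D) (X o)%:E = \int[P]_(o in D) (y o)%:E) ->
  (\int[P]_o (h (phi o) * X o) = \int[P]_o (h (phi o) * y o))%R.
Proof.
move=> mh hM IX Iy XY.
have mhO : measurable_fun setT (fun o : Omega => h (phi o)) by exact: sub_measurable_fun.
have M0 : (0 <= M)%R := le_trans (normr_ge0 _) (hM point).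
(* Shifting [h] by [M], and [X] and [y] by [Z], makes all factors nonnegative. *)
pose Z o := (`|X o| + `|y o|)%R.
have IZ : P.-integrable setT (EFin \o Z).
  by apply: integrable_EFinD; exact: integrable_norm.
pose k t := (h t + M)%R.
have mk : measurable_fun setT (EFin \o k).
  by apply/measurable_EFinP; exact: measurable_funD.
have k0 t : (0 <= k t)%R by rewrite -lerBlDr sub0r; have := hM t; rewrite ler_norml => /andP[].
have mW (W : Omega -> R) : P.-integrable setT (EFin \o W) ->
    measurable_fun setT (fun o => W o + Z o)%R.
  by move=> IW; apply: measurable_funD; exact: (@integrable_EFin_measurable _ _ _ P).
have keyE : \int[P]_o (k (phi o) * (X o + Z o)%R)%:E = \int[P]_o (k (phi o) * (y o + Z o)%R)%:E.
  rewrite (ge0_integralM_lim k mk (fun o => X o + Z o)%R)//; last 2 first.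
  - exact: mW.
  - by move=> o; rewrite /Z addrA addr_ge0// -lerBlDr sub0r lerNl ler_normr lexx orbT.
  rewrite (ge0_integralM_lim k mk (fun o => y o + Z o)%R)//; last 2 first.
  - exact: mW.
  - by move=> o; rewrite /Z addrCA addr_ge0// -lerBlDr sub0r lerNl ler_normr lexx orbT.
  congr (lim (_ @ \oo)); apply/funext => n /=; apply: eq_fsbigr => r _; congr (_ * _).
  set D := _ @^-1` _.
  have SD : <<s Gen >> D.
    exact: (measurable_sfunP (nnsfun_approx measurableT mk n) (measurable_set1 r)).
  have mD := hS _ SD.
  under eq_integral do rewrite EFinD.
  under [RHS]eq_integral do rewrite EFinD.
  have sub (W : Omega -> R) : P.-integrable setT (EFin \o W) -> P.-integrable D (EFin \o W).
    by move=> IW; exact: integrableS IW.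
  by rewrite !integralD ?XY//; exact: sub.
(* The shifts are undone by $hW = k(W+Z) - (kZ + MW)$, where $k = h+M$. *)
have split_int (W : Omega -> R) : P.-integrable setT (EFin \o W) ->
    (\int[P]_o (h (phi o) * W o) =
     fine (\int[P]_o (k (phi o) * (W o + Z o)%R)%:E)
     - (\int[P]_o (k (phi o) * Z o) + M * \int[P]_o W o))%R.
  move=> IW.
  have kM t : (`|k t| <= M + M)%R by rewrite (le_trans (ler_normD _ _))// lerD ?hM// ger0_norm.
  have mkO : measurable_fun setT (fun o : Omega => k (phi o)) by exact: measurable_funD.
  have IkZ : P.-integrable setT (EFin \o (fun o => k (phi o) * Z o)%R).
    exact: (integrable_bounded_mul (M + M)).
  have IkWZ : P.-integrable setT (EFin \o (fun o => k (phi o) * (W o + Z o))%R).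
    by apply: (integrable_bounded_mul (M + M)) => //; exact: integrable_EFinD.
  have IMW := integrable_EFinZ M W IW.
  rewrite -RintegralZl// -RintegralD// -RintegralB//; last exact: integrable_EFinD.
  by apply: eq_Rintegral => o _; rewrite /k; ring.
rewrite (split_int X IX) (split_int y Iy) keyE; congr (_ - (_ + _ * _))%R.
by rewrite /Rintegral XY//; exact: (@measurableT _ T).
Qed.

End condexp_existence.

(** * Conditional expectation inside an inner product *)

Section condexp_pullout.
Context {dO : measure_display} {Omega : measurableType dO} {R : realType}.
Context (P : probability Omega R) (Gen : set (set Omega)).
Hypothesis hS : <<s Gen >> `<=` measurable.

Lemma condexp_is_condexp (X : Omega -> \bar R) :
  (exists Y, is_condexp P <<s Gen >> X Y) ->
  is_condexp P <<s Gen >> X (condexp P <<s Gen >> X).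
Proof. by move=> h; rewrite /condexp; have := xgetPex (cst 0%E) h. Qed.

(** The events $\{Y\ge0\}$ and $\{Y<0\}$ lie in the sub-sigma-algebra, so the integral of $Y$ over
    each equals that of $X$ and is finite. *)
Lemma condexp_integrable (X Y : Omega -> \bar R) : P.-integrable setT X ->
  is_condexp P <<s Gen >> X Y -> P.-integrable setT Y.
Proof.
move=> IX cY; have mY := condexp_measurable P Gen hS X Y cY; case: cY => [SY YX].
apply/integrableP; split=> //.
pose D := Y @^-1` `[0%E, +oo[%classic.
pose D' := Y @^-1` `]-oo, 0%E[%classic.
have SD : <<s Gen >> D by apply: SY; exact: emeasurable_itv.
have SD' : <<s Gen >> D' by apply: SY; exact: emeasurable_itv.
have Dpos o : D o -> (0 <= Y o)%E by rewrite /D /= in_itv /= andbT.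
have Dneg o : D' o -> (Y o < 0)%E by rewrite /D' /= in_itv.
have DU : D `|` D' = setT.
  apply/seteqP; split=> // o _; rewrite /D /D' /= !in_itv /= andbT.
  by apply/orP; rewrite leNgt orNb.
have DI : [disjoint D & D'].
  apply/disj_setPS => o [/Dpos h /Dneg]; rewrite ltNge h //.
have fin (E : set Omega) : <<s Gen >> E -> (\int[P]_(o in E) Y o)%E \is a fin_num.
  move=> SE; rewrite YX//; apply: integrable_fin_num; first exact: hS.
  by apply: (integrableS measurableT _ _ IX) => //; exact: hS.
rewrite -DU ge0_integral_setU//;
  [|exact: hS|exact: hS|by apply: measurable_funTS; exact: measurableT_comp].
apply: lte_add_pinfty.
  rewrite (eq_integral Y); last by move=> o; rewrite inE => /Dpos h; rewrite gee0_abs.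
  by have := fin _ SD; rewrite fin_numE => /andP[_]; rewrite -ltey.
have -> : (\int[P]_(o in D') `|Y o| = - \int[P]_(o in D') Y o)%E.
  rewrite -[LHS]oppeK -integral_ge0N//; congr (- _)%E; apply: eq_integral => o.
  by rewrite inE => /Dneg h; rewrite lte0_abs// oppeK.
by have := fin _ SD'; rewrite -fin_numN fin_numE => /andP[_]; rewrite -ltey.
Qed.

(** [condexp_vec] applies [fine]; this alters the version only on a null set, since an integrable
    version is finite almost everywhere. *)
Lemma condexp_fine_integral (X : Omega -> R) : P.-integrable setT (EFin \o X) ->
  let y := fun o => fine (condexp P <<s Gen >> (fun o' => (X o')%:E) o) in
  P.-integrable setT (EFin \o y) /\
  forall D, <<s Gen >> D -> (\int[P]_(o in D) (X o)%:E = \int[P]_(o in D) (y o)%:E)%E.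
Proof.
move=> IX y; have cY := condexp_is_condexp _ (integrable_condexp_exists P Gen hS _ IX).
set Y := condexp P <<s Gen >> _ in cY.
have IY := condexp_integrable _ Y IX cY.
have mY := condexp_measurable P Gen hS _ Y cY.
have my : measurable_fun setT (EFin \o y).
  by apply/measurable_EFinP; exact: measurableT_comp.
have yY : {ae P, forall o, (y o)%:E = Y o}.
  apply: filterS (integrable_ae measurableT IY) => o /(_ I) h; exact: fineK.
have yYD (D : set Omega) : measurable D -> (\int[P]_(o in D) (y o)%:E = \int[P]_(o in D) Y o)%E.
  move=> mD; apply: ae_eq_integral => //; [exact: measurable_funTS..|].
  by apply: filterS yY => o -> _.
split; last by move=> D SD; rewrite yYD; [case: cY => _ ->|exact: hS].
apply/integrableP; split=> //.
have /integrableP[_] := IY; congr (_ < _)%E.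
apply: ae_eq_integral => //; [exact: measurableT_comp..|].
by apply: filterS yY => o <- _.
Qed.

(** Dominated convergence, with dominating function $|\phi|$. It removes the truncation in
    [condexp_inner_lower]. *)
Lemma Rintegral_ge0_exhaustion (phi : Omega -> R) (D : nat -> set Omega) :
  P.-integrable setT (EFin \o phi) -> (forall n, measurable (D n)) ->
  (forall o, \forall n \near \oo, D n o) ->
  (forall n, 0 <= \int[P]_o (\1_(D n) o * phi o)) -> 0 <= \int[P]_o phi o.
Proof.
move=> Iphi mD Dn h.
have mphi := integrable_EFin_measurable _ Iphi.
have IDphi n : P.-integrable setT (EFin \o (fun o => \1_(D n) o * phi o)).
  apply: (integrable_bounded_mul 1) => // o; rewrite indicE.
  by case: (_ \in _); rewrite ?normr1 ?normr0.
have cvg : (\int[P]_o (\1_(D n) o * phi o)%:E)%E @[n --> \oo] --> (\int[P]_o (phi o)%:E)%E.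
  apply: (@dominated_cvg _ _ _ P setT measurableT
    (fun n o => (\1_(D n) o * phi o)%:E) _ (fun o => `|phi o|%:E)) => //.
  - by move=> n; exact: measurable_int (IDphi n).
  - move=> o _; apply: cvg_near_cst; apply: filterS (Dn o) => n Dno.
    by rewrite indicE mem_set// mul1r.
  - exact: integrable_norm.
  - move=> n o _; rewrite lee_fin normrM indicE.
    by case: (_ \in _); rewrite ?normr1 ?normr0 ?mul1r ?mul0r.
rewrite -lee_fin /Rintegral fineK; last exact: integrable_fin_num.
apply: cvge_ge cvg; apply: nearW => n; have := h n.
by rewrite -lee_fin /Rintegral fineK//; exact: (integrable_fin_num measurableT (IDphi n)).
Qed.

Lemma integrable_coord {d : nat} (V : Omega -> 'rV[R]_d) (i : 'I_d) :
  measurable_fun setT (fun o => V o 0 i) ->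
  P.-integrable setT (EFin \o (fun o => enorm (V o) ^+ 2)) ->
  P.-integrable setT (EFin \o (fun o => V o 0 i)).
Proof.
move=> mV IV; apply: (integrable_dominated _ (fun o => enorm (V o) ^+ 2 + 1)) => //.
  apply: integrable_EFinD => //; exact: finite_measure_integrable_cst.
by move=> o; exact: normr_coord_le.
Qed.

Lemma integrable_inner {d : nat} (V h : Omega -> 'rV[R]_d) :
  (forall i, measurable_fun setT (fun o => V o 0 i)) ->
  (forall i, measurable_fun setT (fun o => h o 0 i)) ->
  P.-integrable setT (EFin \o (fun o => enorm (V o) ^+ 2)) ->
  P.-integrable setT (EFin \o (fun o => enorm (h o) ^+ 2)) ->
  P.-integrable setT (EFin \o (fun o => inner (V o) (h o))).
Proof.
move=> mV mh IV Ih.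
apply: (integrable_dominated _ (fun o => 2^-1 * (enorm (V o) ^+ 2 + enorm (h o) ^+ 2))).
- by apply: measurable_sum => i; exact: measurable_funM.
- by apply: integrable_EFinZ; exact: integrable_EFinD.
- move=> o; rewrite mulrC; exact: normr_inner_le.
Qed.

(** It integrates the conditional inequality, with $h=\nabla F(w_k)$ in view. As $h$ may be
    unbounded, the pull-out is done coordinate by coordinate on the events $\|h\|^2\le n$, which
    exhaust the space. *)
Lemma condexp_inner_lower {d : nat} (V h : Omega -> 'rV[R]_d) (s : R) :
  (forall i, measurable_fun setT (fun o => V o 0 i)) ->
  (forall i, measurable_fun [set: g_sigma_algebraType Gen]
     (fun t : g_sigma_algebraType Gen => h t 0 i)) ->
  P.-integrable setT (EFin \o (fun o => enorm (V o) ^+ 2)) ->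
  P.-integrable setT (EFin \o (fun o => enorm (h o) ^+ 2)) ->
  {ae P, forall o, s * enorm (h o) ^+ 2 <=
                   inner (condexp_vec P <<s Gen >> V o) (h o)} ->
  s * \int[P]_o (enorm (h o) ^+ 2) <= \int[P]_o inner (V o) (h o).
Proof.
move=> mV mh IV Ih hVh.
have mhO i : measurable_fun setT (fun o => h o 0 i).
  by apply: (sub_measurable_fun Gen hS); exact: mh.
have IVh := integrable_inner V h mV mhO IV Ih.
rewrite -RintegralZl// -subr_ge0 -RintegralB//; last exact: integrable_EFinZ.
pose D (n : nat) := [set o | inner (h o) (h o) <= n%:R].
have SD n : <<s Gen >> (D n).
  have minn : measurable_fun [set: g_sigma_algebraType Gen]
      (fun t : g_sigma_algebraType Gen => inner (h t) (h t)).
    by apply: measurable_sum => i; exact: measurable_funM.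
  have := minn measurableT `]-oo, n%:R]%classic (measurable_itv _).
  by rewrite setTI; congr (<<s _ >> _); apply/seteqP; split=> o; rewrite /D /= in_itv.
apply: (Rintegral_ge0_exhaustion _ D).
- by apply: integrable_EFinB => //; exact: integrable_EFinZ.
- by move=> n; exact: hS.
- move=> o; exists (Num.trunc (inner (h o) (h o))).+1 => // n /= hn.
  by rewrite /D /= ltW// (lt_le_trans (truncnS_gt _))// ler_nat.
move=> n.
pose y i o := fine (condexp P <<s Gen >> (fun o' => (V o' 0 i)%:E) o).
have hy i := condexp_fine_integral _ (integrable_coord V i (mV i) IV).
have mD : measurable_fun [set: g_sigma_algebraType Gen]
   (\1_(D n) : g_sigma_algebraType Gen -> R) by apply: measurable_indic; exact: SD.
pose k i (t : g_sigma_algebraType Gen) := \1_(D n) t * h t 0 i.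
have mk i : measurable_fun setT (k i) by exact: measurable_funM.
have mkO i : measurable_fun setT (fun o : Omega => k i o) by apply: (sub_measurable_fun Gen hS).
(* The bound $n+1$ is that of [normr_coord_le] on the truncation event. *)
have kn i t : `|k i t| <= n%:R + 1.
  rewrite /k indicE; case: (boolP (_ \in _)) => [|_]; last by rewrite mul0r normr0.
  rewrite inE /D /= => hn; rewrite mul1r (le_trans (normr_coord_le _ _))//.
  by rewrite enorm_sqr lerD2r.
have E i : \int[P]_o (k i o * V o 0 i) = \int[P]_o (k i o * y i o).
  have [Iy Vy] := hy i.
  by apply: (Rintegral_bounded_mul_eq P Gen hS (n%:R + 1) (k i)) => //; exact: integrable_coord.
have IkV i : P.-integrable setT (EFin \o (fun o => k i o * V o 0 i)).
  by apply: (integrable_bounded_mul (n%:R + 1)) => //; exact: integrable_coord.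
have Iky i : P.-integrable setT (EFin \o (fun o => k i o * y i o)).
  by apply: (integrable_bounded_mul (n%:R + 1)) => //; have [] := hy i.
have IDh : P.-integrable setT (EFin \o (fun o => \1_(D n) o * (s * enorm (h o) ^+ 2))).
  apply: (integrable_bounded_mul 1).
  - by apply: measurable_indic; exact: hS.
  - by move=> o; rewrite indicE; case: (_ \in _); rewrite ?normr1 ?normr0.
  - exact: integrable_EFinZ.
have -> : \int[P]_o (\1_(D n) o * (inner (V o) (h o) - s * enorm (h o) ^+ 2)) =
  \sum_(i < d) \int[P]_o (k i o * V o 0 i) - \int[P]_o (\1_(D n) o * (s * enorm (h o) ^+ 2)).
  rewrite -Rintegral_sum// -RintegralB//; last exact: integrable_EFin_sum.
  apply: eq_Rintegral => o _; rewrite mulrBr; congr (_ - _).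
  by rewrite mulr_sumr; apply: eq_bigr => i _; rewrite /k; ring.
under eq_bigr do rewrite E.
rewrite -Rintegral_sum// subr_ge0; apply: ae_le_Rintegral => //.
  exact: integrable_EFin_sum.
apply: filterS hVh => o ho.
rewrite (_ : \sum_(i < d) _ = \1_(D n) o * inner (condexp_vec P <<s Gen >> V o) (h o)).
  by rewrite ler_wpM2l// indicE.
by rewrite mulr_sumr; apply: eq_bigr => i _; rewrite /k /y mxE; ring.
Qed.
End condexp_pullout.

(** * The expected descent of one iteration *)

Section borel_vectors.
Context {dT : measure_display} {T : measurableType dT} {R : realType} {d : nat}.

Lemma continuous_rvec_measurable (V : T -> 'rV[R]_d) (phi : 'rV[R]_d -> R) :
  rvec_measurable measurable V -> continuous phi ->
  measurable_fun setT (fun t => phi (V t)).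
Proof.
move=> mV cphi; apply: (measurability _ (RGenOpens.measurableE R)).
move=> _ [_ [a [b ->]] <-]; rewrite setTI.
apply: (mV (phi @^-1` `]a, b[)); apply: sub_sigma_algebra.
by move/continuousP : cphi; apply; exact: interval_open.
Qed.

Lemma coord_rvec_measurable (V : T -> 'rV[R]_d) (f : 'rV[R]_d -> 'rV[R]_d) i :
  rvec_measurable measurable V -> continuous f ->
  measurable_fun setT (fun t => f (V t) 0 i).
Proof.
move=> mV cf; apply: (continuous_rvec_measurable V (fun v => f v 0 i)) => // v.
exact: (continuous_comp (cf v) (@coord_continuous R 1 d 0 i (f v))).
Qed.
End borel_vectors.

Section expected_descent.
Context {dO : measure_display} {Omega : measurableType dO} {R : realType}.
Context (P : probability Omega R) (Gen : set (set Omega)).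
Hypothesis hS : <<s Gen >> `<=` measurable.
Context {d : nat} (F : 'rV[R]_d -> R) (L Flow : R).
Hypothesis L0 : 0 < L.
Hypothesis dF : forall w, differentiable F w.
Hypothesis cF : continuous (grad F).
Hypothesis lipF : forall u v, enorm (grad F u - grad F v) <= L * enorm (u - v).
Hypothesis Flow_le : forall v, Flow <= F v.
Local Notation intg f := (P.-integrable setT (EFin \o f)).

Let cF0 : continuous F.
Proof. by move=> v; exact: differentiable_continuous. Qed.

Lemma rvec_measurable_sub (V : Omega -> 'rV[R]_d) :
  rvec_measurable <<s Gen >> V -> rvec_measurable measurable V.
Proof. by move=> mV D bD; apply: hS; exact: mV. Qed.

Lemma integrable_grad_sqr (w : Omega -> 'rV[R]_d) :
  rvec_measurable measurable w -> intg (fun o => F (w o) - Flow) ->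
  intg (fun o => enorm (grad F (w o)) ^+ 2).
Proof.
move=> mw IF; apply: (integrable_dominated _ (fun o => 2 * L * (F (w o) - Flow))).
- under eq_fun do rewrite enorm_sqr.
  apply: measurable_sum => i; apply: measurable_funM; exact: coord_rvec_measurable.
- exact: integrable_EFinZ.
- by move=> o; rewrite ger0_norm ?exprn_ge0 ?enorm_ge0// grad_sqr_le.
Qed.

(* [cond_moment P S 2 V] may be infinite a priori: the bound makes it finite. *)
Lemma integrable_of_cond_moment (V : Omega -> 'rV[R]_d) (b : Omega -> R) :
  rvec_measurable measurable V -> (forall o, 0 <= b o) -> intg b ->
  {ae P, forall o, (cond_moment P <<s Gen >> 2 V o <= (b o)%:E)%E} ->
  intg (fun o => enorm (V o) ^+ 2) /\
  \int[P]_o (enorm (V o) ^+ 2) <= \int[P]_o b o.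
Proof.
move=> mV b0 Ib Vb.
have mN : measurable_fun setT (fun o => enorm (V o) ^+ 2).
  under eq_fun do rewrite enorm_sqr.
  apply: measurable_sum => i; apply: measurable_funM;
    exact: (coord_rvec_measurable V id _ mV (fun=> cvg_id)).
have N0 o : 0 <= enorm (V o) ^+ 2 by rewrite exprn_ge0 ?enorm_ge0.
have cY := condexp_is_condexp P Gen _ (ge0_condexp_exists P Gen hS _ mN N0).
set Y := condexp _ _ _ in cY.
have mY := condexp_measurable P Gen hS _ Y cY.
have S_T : <<s Gen >> setT.
  exact: (@measurableT _ (g_sigma_algebraType Gen)).
have le_b : (\int[P]_o (enorm (V o) ^+ 2)%:E <= \int[P]_o (b o)%:E)%E.
  case: cY => _ /(_ _ S_T) <-; rewrite integralE.
  (* The version [Y] may be negative on a null set; its positive part is nonnegative everywhere and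
     still at most [b] almost surely, because [b] is nonnegative. *)
  apply: (@le_trans _ _ (\int[P]_o Y^\+ o)%E).
    by rewrite -[leRHS]sube0 leeB// integral_ge0.
  apply: ae_ge0_le_integral => //.
  - exact: measurable_funepos.
  - by move=> o _; rewrite lee_fin.
  - exact: measurable_int Ib.
  - apply: filterS Vb => o h _; rewrite funeposE ge_max lee_fin b0 andbT; exact: h.
have IV : intg (fun o => enorm (V o) ^+ 2).
  apply/integrableP; split; first exact/measurable_EFinP.
  under eq_integral do rewrite /= ger0_norm//.
  apply: le_lt_trans le_b _.
  by have := integrable_fin_num measurableT Ib; rewrite fin_numE -ltey => /andP[].
by split=> //; rewrite /Rintegral fine_le//; exact: integrable_fin_num.
Qed.

(** Integrability of $F(w)-F_{\text{low}}$ is carried along with the inequality, so that induction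
    over the iterations can start from the deterministic $w_0$. *)
Lemma expected_descent (w w' V : Omega -> 'rV[R]_d) (a s A B C : R) :
  0 <= a -> 0 <= A -> 0 <= B -> 0 <= C ->
  rvec_measurable <<s Gen >> w -> rvec_measurable measurable w' ->
  rvec_measurable measurable V -> (forall o, w' o = w o - a *: V o) ->
  {ae P, forall o, (cond_moment P <<s Gen >> 2 V o <=
     (2 * A * (F (w o) - Flow) + B * enorm (grad F (w o)) ^+ 2 + C)%:E)%E} ->
  {ae P, forall o, s * enorm (grad F (w o)) ^+ 2 <=
     inner (condexp_vec P <<s Gen >> V o) (grad F (w o))} ->
  intg (fun o => F (w o) - Flow) ->
  intg (fun o => F (w' o) - Flow) /\
  \int[P]_o (F (w' o) - Flow) <=
    (1 + L * A * a ^+ 2) * \int[P]_o (F (w o) - Flow)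
    - (a * s - L * B * a ^+ 2 / 2) * \int[P]_o (enorm (grad F (w o)) ^+ 2)
    + L * C * a ^+ 2 / 2.
Proof.
move=> a0 A0 B0 C0 mwS mw' mV hw' V2 Vh IF.
have mw := rvec_measurable_sub w mwS.
have Ig := integrable_grad_sqr w mw IF.
set b := fun o => 2 * A * (F (w o) - Flow) + B * enorm (grad F (w o)) ^+ 2 + C.
have I1 := integrable_EFinZ (2 * A) _ IF; have I2 := integrable_EFinZ B _ Ig.
have I12 := integrable_EFinD _ _ I1 I2.
have IC : intg (fun=> C) by exact: finite_measure_integrable_cst.
have Ib : intg b by exact: integrable_EFinD.
have b0 o : 0 <= b o.
  by rewrite /b !addr_ge0// mulr_ge0 ?exprn_ge0 ?enorm_ge0 ?subr_ge0 ?mulr_ge0.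
have [IV Vb] := integrable_of_cond_moment V b mV b0 Ib V2.
have intb : \int[P]_o b o = 2 * A * \int[P]_o (F (w o) - Flow)
    + B * \int[P]_o (enorm (grad F (w o)) ^+ 2) + C.
  rewrite (RintegralD measurableT I12 IC) (RintegralD measurableT I1 I2).
  rewrite (RintegralZl _ measurableT IF) (RintegralZl _ measurableT Ig); congr (_ + _).
  by rewrite Rintegral_cst// [X in fine X](probability_setT P) mulr1.
have mgS i : measurable_fun [set: g_sigma_algebraType Gen]
    (fun t : g_sigma_algebraType Gen => grad F (w t) 0 i).
  exact: (@coord_rvec_measurable _ (g_sigma_algebraType Gen)).
have mg i : measurable_fun setT (fun o => grad F (w o) 0 i) by exact: coord_rvec_measurable.
have mVi i : measurable_fun setT (fun o => V o 0 i).
  exact: (coord_rvec_measurable V id _ mV (fun=> cvg_id)).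
have lower := condexp_inner_lower P Gen hS V (fun o => grad F (w o)) s mVi mgS IV Ig Vh.
have IVg := integrable_inner P V (fun o => grad F (w o)) mVi mg IV Ig.
have step o : F (w' o) - Flow <= F (w o) - Flow
    - a * inner (V o) (grad F (w o)) + L / 2 * a ^+ 2 * enorm (V o) ^+ 2.
  have := descent_lemma F L (w o) (w' o) dF lipF.
  have -> : w' o - w o = - (a *: V o) by rewrite hw' addrAC subrr add0r.
  rewrite innerNr innerZr (innerC (grad _ _)) enormN enormZ exprMn real_normK ?num_real//.
  lra.
have Ia := integrable_EFinZ a _ IVg.
have Iq := integrable_EFinZ (L / 2 * a ^+ 2) _ IV.
have Ir := integrable_EFinD _ _ (integrable_EFinB _ _ IF Ia) Iq.
(* The pointwise descent inequality supplies the integrable dominating function. *)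
have IF' : intg (fun o => F (w' o) - Flow).
  apply: (integrable_dominated _ _ _ Ir).
    by apply: measurable_funB => //; exact: continuous_rvec_measurable.
  by move=> o; rewrite ger0_norm ?subr_ge0//; exact: step.
split=> //.
have := le_Rintegral measurableT IF' Ir (fun o _ => step o).
rewrite (RintegralD measurableT (integrable_EFinB _ _ IF Ia) Iq).
rewrite (RintegralB measurableT IF Ia) (RintegralZl _ measurableT IVg).
rewrite (RintegralZl _ measurableT IV) => /le_trans; apply.
rewrite intb in Vb.
move: lower Vb; move: (\int[P]_o (F (w o) - Flow)) => D.
move: (\int[P]_o inner _ _) (\int[P]_o (enorm (V o) ^+ 2)) => u v.
move: (\int[P]_o (enorm _ ^+ 2)) => g /(ler_wpM2l a0) h1 h2.
have La : 0 <= L / 2 * a ^+ 2 by rewrite mulr_ge0 ?sqr_ge0// divr_ge0 ?ltW.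
have := ler_wpM2l La h2; lra.
Qed.
End expected_descent.

(** * Smoothness of the averaged objective *)

Section mean_objective.
Context {R : realType} {d : nat}.

Lemma enormD (u v : 'rV[R]_d) : enorm (u + v) <= enorm u + enorm v.
Proof.
rewrite -(@ler_pXn2r _ 2)// ?nnegrE ?addr_ge0 ?enorm_ge0//.
rewrite enorm_sqr innerDl !innerDr (innerC v u) -!enorm_sqr.
by have := inner_le_enorm u v; lra.
Qed.

Lemma enorm0 : enorm (0 : 'rV[R]_d) = 0.
Proof. by rewrite /enorm /inner big1 ?sqrtr0// => i _; rewrite mxE mul0r. Qed.

Lemma smooth_mean (m : nat) (L : R) (Fi : 'I_m -> 'rV[R]_d -> R) F : (0 < m)%N ->
  (forall w, F w = m%:R^-1 * \sum_(i < m) Fi i w) ->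
  (forall i, smooth L (Fi i)) -> smooth L F.
Proof.
move=> m0 hF hFi.
have dFi i w : differentiable (Fi i) w by have [+ _ _] := hFi i; exact.
have gF w : grad F w = m%:R^-1 *: \sum_(i < m) grad (Fi i) w.
  by have [] := grad_mean m Fi F w hF dFi.
split=> [w||v w].
- by have [] := grad_mean m Fi F w hF dFi.
- rewrite (_ : grad F = fun w => m%:R^-1 *: \sum_(i < m) grad (Fi i) w); last exact/funext.
  pose M : normedModType R := 'rV[R]_d.
  have cg i : continuous (grad (Fi i) : M -> M) by have [_ + _] := hFi i.
  have h (r : seq 'I_m) : continuous ((fun w => \sum_(i <- r) grad (Fi i) w) : M -> M).
    elim: r => [|i r IH] w.
      under eq_fun do rewrite big_nil.
      exact: (@cvg_cst M (0 : M) M (nbhs w)).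
    under eq_fun do rewrite big_cons.
    exact: (cvgD (cg i w) (IH w)).
  move=> w; exact: (@cvgZr _ M _ _ _ _ _ _ (h _ w)).
- rewrite !gF -scalerBr -sumrB enormZ ger0_norm ?invr_ge0 ?ler0n//.
  rewrite ler_pdivrMl ?ltr0n//.
  apply: (@le_trans _ _ (\sum_(i < m) L * enorm (v - w))); last first.
    by rewrite sumr_const card_ord mulr_natl.
  elim/big_ind2: _ => [|a b a' b' ha hb|i _].
  + by rewrite enorm0.
  + by rewrite (le_trans (enormD _ _))// lerD.
  + by have [_ _] := hFi i; exact.
Qed.

(** Two distinct points exist when $d>0$, and the Lipschitz bound between them forces the sign. With
    $LB'>0$ this yields $L>0$. *)
Lemma smooth_constant_ge0 (L : R) (F : 'rV[R]_d -> R) : (0 < d)%N -> smooth L F -> 0 <= L.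
Proof.
move=> d0 [_ _ lip]; pose u : 'rV[R]_d := const_mx 1.
have u0 : 0 < enorm (u - 0).
  rewrite subr0 /enorm sqrtr_gt0 /inner.
  under eq_bigr do rewrite mxE mulr1.
  by rewrite sumr_const card_ord ltr0n.
by have := le_trans (enorm_ge0 _) (lip u 0); rewrite pmulr_lge0.
Qed.
End mean_objective.

Lemma past_sub_measurable (dO dZ : measure_display) (Omega : measurableType dO)
  (Z : measurableType dZ) (m : nat) (zeta : nat -> 'I_m -> Omega -> Z) (k : nat) :
  (forall k i, measurable_fun setT (zeta k i)) -> past zeta k `<=` measurable.
Proof.
move=> mzeta; apply: smallest_sub; first exact: sigma_algebra_measurable.
by move=> _ [i [j [S [_ mS ->]]]]; rewrite -[_ @^-1` _]setTI; exact: mzeta.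
Qed.

(** Jensen's inequality for the square, obtained by integrating $f \le f^2/(2t) + t/2$ and letting
    $t$ decrease to $\sqrt M$. *)
Lemma expectation_le_sqrt (dO : measure_display) (Omega : measurableType dO) (R : realType)
  (P : probability Omega R) (f : Omega -> R) (M : R) :
  (forall o, 0 <= f o) -> P.-integrable setT (EFin \o (fun o => f o ^+ 2)) ->
  0 <= M -> \int[P]_o (f o ^+ 2) <= M -> ('E_P[f] <= (Num.sqrt M)%:E)%E.
Proof.
move=> f0 If2 M0 fM.
have mf : measurable_fun setT f.
  rewrite (_ : f = fun o => Num.sqrt (f o ^+ 2)); last first.
    by apply/funext => o; rewrite sqrtr_sqr ger0_norm.
  apply: measurableT_comp; first by apply: continuous_measurable_fun; exact: sqrt_continuous.
  exact: (@integrable_EFin_measurable _ _ _ P).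
have I1 c : P.-integrable setT (EFin \o (fun=> c)) by exact: finite_measure_integrable_cst.
have If : P.-integrable setT (EFin \o f).
  apply: (integrable_dominated _ (fun o => f o ^+ 2 + 1)) => //.
    exact: integrable_EFinD.
  move=> o; rewrite ger0_norm//; have : 0 <= (f o - 1) ^+ 2 by exact: sqr_ge0.
  by have := f0 o; lra.
rewrite unlock -[leLHS]fineK; last exact: (integrable_fin_num measurableT If).
rewrite lee_fin; apply/ler_addgt0Pr => e e0.
(* The slack [e] keeps $t$ positive even when $M=0$. *)
set t := Num.sqrt M + e; have t0 : 0 < t by rewrite ltr_wpDl ?sqrtr_ge0.
have tM : M <= t ^+ 2.
  rewrite -{1}(sqr_sqrtr M0) lerXn2r ?nnegrE ?sqrtr_ge0 ?(ltW t0)//.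
  by rewrite lerDl ltW.
have E2 a : 2 * t * ((2 * t)^-1 * a + t / 2) = a + t ^+ 2 by field; rewrite gt_eqF.
have Ig := integrable_EFinD _ _ (integrable_EFinZ ((2 * t)^-1) _ If2) (I1 (t / 2)).
apply: (le_trans (le_Rintegral measurableT If Ig _)) => [x _ /=|/=].
  rewrite -(ler_pM2l (_ : 0 < 2 * t)) ?mulr_gt0//.
  by rewrite E2; have := sqr_ge0 (f x - t); lra.
rewrite (RintegralD measurableT (integrable_EFinZ ((2 * t)^-1) _ If2) (I1 _)).
rewrite (RintegralZl _ measurableT If2) Rintegral_cst// [X in fine X](probability_setT P) mulr1.
rewrite -(ler_pM2l (_ : 0 < 2 * t)) ?mulr_gt0//.
by rewrite E2; lra.
Qed.

(** * Convergence *)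

(** Gronwall bounds a weighted sum of the $\mathbb{E}\|\nabla F(w_k)\|^2$, hence the smallest of
    them, all weights being at least the last one. The product is left as it stands for the theorem
    to estimate in two ways. *)
Lemma min_expected_grad_le (dO dZ : measure_display) (Omega : measurableType dO)
    (Z : measurableType dZ) (R : realType) (P : probability Omega R) (m d : nat)
    (zeta : nat -> 'I_m -> Omega -> Z) (F : 'rV[R]_d -> R) (L Flow : R)
    (w V : nat -> Omega -> 'rV[R]_d) (w0 : 'rV[R]_d) (lr : nat -> R) (s A B C : R) (K : nat) :
  (forall k i, measurable_fun setT (zeta k i)) ->
  0 < L -> smooth L F -> (forall v, Flow <= F v) ->
  (forall o, w 0%N o = w0) -> (forall k o, w k.+1 o = w k o - lr k *: V k o) ->
  (forall k, rvec_measurable (past zeta k) (w k)) ->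
  (forall k, rvec_measurable measurable (V k)) ->
  0 <= A -> 0 <= B -> 0 <= C ->
  (forall k, {ae P, forall o, (cond_moment P (past zeta k) 2 (V k) o <=
     (2 * A * (F (w k o) - Flow) + B * enorm (grad F (w k o)) ^+ 2 + C)%:E)%E}) ->
  (forall k, {ae P, forall o, s * enorm (grad F (w k o)) ^+ 2 <=
     inner (condexp_vec P (past zeta k) (V k) o) (grad F (w k o))}) ->
  0 < s -> (forall k, 0 < lr k) -> (forall k, L * B * lr k <= s) ->
  {homo lr : i j / (i <= j)%N >-> j <= i} -> (0 < K)%N ->
  (\big[mine/+oo%E]_(k < K) 'E_P[fun o => enorm (grad F (w k o))] <=
   (Num.sqrt (\prod_(k < K) (1 + L * A * lr k ^+ 2) *
      (2 * (F w0 - Flow) + L * C * \sum_(k < K) lr k ^+ 2) /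
      (s * K%:R * lr K.-1)))%:E)%E.
Proof.
move=> mzeta L0 smF Flow_le w0E wS mw mV A0 B0 C0 V2 Vh s0 lr0 lrs lrd K0.
have [dF cF lipF] := smF.
have hS k := past_sub_measurable dO dZ Omega Z m zeta k mzeta.
have mwO k : rvec_measurable measurable (w k) by move=> D bD; apply: (hS k); exact: mw.
pose I k := P.-integrable setT (EFin \o (fun o => F (w k o) - Flow)).
have step k : I k -> I k.+1 /\ _ := expected_descent P _ (hS k) F L Flow L0 dF cF lipF Flow_le
  (w k) (w k.+1) (V k) (lr k) s A B C (ltW (lr0 k)) A0 B0 C0 (mw k) (mwO k.+1) (mV k)
  (wS k) (V2 k) (Vh k).
have hI k : I k.
  elim: k => [|k /step[]//].
  rewrite /I (_ : (fun o => F (w 0%N o) - Flow) = fun=> F w0 - Flow).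
    exact: finite_measure_integrable_cst.
  by apply/funext => o; rewrite w0E.
pose dl k := \int[P]_o (F (w k o) - Flow).
pose G k := \int[P]_o (enorm (grad F (w k o)) ^+ 2).
have hrec k : dl k.+1 <= (1 + L * A * lr k ^+ 2) * dl k
    - (lr k * s - L * B * lr k ^+ 2 / 2) * G k + L * C * lr k ^+ 2 / 2.
  by have [] := step k (hI k).
have IG k := integrable_grad_sqr P F L Flow L0 dF cF lipF Flow_le (w k) (mwO k) (hI k).
have G0 k : 0 <= G k by apply: Rintegral_ge0 => o _; rewrite exprn_ge0 ?enorm_ge0.
have dl0 k : 0 <= dl k by apply: Rintegral_ge0 => o _; rewrite subr_ge0.
have dl0E : dl 0%N = F w0 - Flow.
  rewrite /dl; under eq_Rintegral do rewrite w0E.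
  by rewrite Rintegral_cst// [X in fine X](probability_setT P) mulr1.
have e0 k : 0 <= s * lr k / 2 by rewrite divr_ge0// mulr_ge0 ?ltW.
have gron := gronwall_sum R dl G (fun k => L * A * lr k ^+ 2) (fun k => L * C * lr k ^+ 2 / 2)
  (fun k => s * lr k / 2) K dl0.
have {}gron : dl K + \sum_(k < K) s * lr k / 2 * G k <=
    \prod_(k < K) (1 + L * A * lr k ^+ 2) * (dl 0%N + \sum_(k < K) L * C * lr k ^+ 2 / 2).
  apply: gron => k /=.
  - by rewrite divr_ge0// mulr_ge0 ?sqr_ge0// mulr_ge0// ltW.
  - by rewrite mulr_ge0 ?sqr_ge0// mulr_ge0// ltW.
  - exact: mulr_ge0.
  (* Since $LB\,\alpha_k\le s$, the quadratic term absorbs at most half of $s\alpha_k G_k$. *)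
  - have := hrec k; have h : L * B * lr k ^+ 2 / 2 * G k <= s * lr k / 2 * G k.
      rewrite ler_wpM2r// ler_pM2r ?invr_gt0// expr2 mulrA ler_pM2r//.
    lra.
set Pr := \prod_(k < K) _ in gron *; set S := \sum_(k < K) lr k ^+ 2.
set den := s * K%:R * lr K.-1.
have den0 : 0 < den by rewrite !mulr_gt0// ltr0n.
set M := Pr * _ / den.
have M0 : 0 <= M.
  rewrite divr_ge0 ?(ltW den0)// mulr_ge0//.
    by apply: prodr_ge0 => k _; rewrite addr_ge0// mulr_ge0 ?sqr_ge0// mulr_ge0// ltW.
  rewrite addr_ge0 ?mulr_ge0 ?subr_ge0 ?(ltW L0)//.
  by apply: sumr_ge0 => k _; exact: sqr_ge0.
(* Otherwise every term exceeds $M$. As $K$ copies of $M$ with the smallest weight $s\alpha_{K-1}/2$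
   add up exactly to the Gronwall bound, this is a contradiction. *)
have [k Gk] : exists k : 'I_K, G k <= M.
  apply/existsP; rewrite -[X in is_true X]negbK negb_exists; apply/negP => /forallP /= h.
  have h' (k : 'I_K) : s * lr K.-1 / 2 * M < s * lr k / 2 * G k.
    apply: (@lt_le_trans _ _ (s * lr K.-1 / 2 * G k)).
      by rewrite ltr_pM2l ?divr_gt0 ?mulr_gt0// ltNge h.
    rewrite ler_wpM2r// ler_pM2r ?invr_gt0// ler_pM2l// lrd//.
    by rewrite -ltnS prednK.
  have : \sum_(k < K) s * lr K.-1 / 2 * M < \sum_(k < K) s * lr k / 2 * G k.
    by apply: ltr_sum => //; apply/hasP; exists (Ordinal K0) => //; rewrite mem_index_enum.
  rewrite sumr_const card_ord.
  have -> : s * lr K.-1 / 2 * M *+ K = Pr * (dl 0%N + L * C * S / 2).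
    rewrite -[LHS]mulr_natr dl0E /M /den; field.
    by rewrite !gt_eqF ?ltr0n.
  move: gron; rewrite -mulr_suml -mulr_sumr -/S.
  have := dl0 K; lra.
apply: le_trans (bigmin_le _ k _) _.
by apply: expectation_le_sqrt => // o; exact: enorm_ge0.
Qed.

Lemma sin_lt1 (R : realType) (x : R) : 0 <= x < pi / 2 -> sin x < 1.
Proof.
move=> /andP[x0 x1].
have c0 : 0 < cos x.
  by apply: cos_gt0_pihalf; rewrite x1 andbT (lt_le_trans _ x0)// oppr_lt0 divr_gt0// pi_gt0.
rewrite ltNge; apply/negP => /(@exprn_ege1 _ 2).
by have := cos2Dsin2 x; have := exprn_gt0 2 c0; lra.
Qed.

Lemma powR_half_sqr (R : realType) (x a : R) : 0 < x -> (x `^ (a / 2)) ^+ 2 = x `^ a.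
Proof.
by move=> x0; rewrite -powR_mulrn ?powR_ge0// -powRrM mulfVK// pnatr_eq0.
Qed.

Theorem corollary4p1 (R : realType) (alpha p : R)
    (halpha : 0 <= alpha < pi / 2) (hp : 1 / 2 < p < 1) :
  exists (c : R) (K0 : nat), 0 < c /\
  forall
    (* the finite-sum problem *)
    (d m : nat) (X Y V : Type) (l : Y -> V -> R) (f : X -> 'rV[R]_d -> V)
    (n : 'I_m -> nat) (hn : forall i, (0 < n i)%N)
    (x : forall i, 'I_(n i) -> X) (y : forall i, 'I_(n i) -> Y)
    (Fi : 'I_m -> 'rV[R]_d -> R) (F : 'rV[R]_d -> R)
    (hFi : forall i w, Fi i w = empirical_risk l f (x i) (y i) w)
    (hF : forall w, F w = m%:R^-1 * \sum_(i < m) Fi i w)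
    (* samples, Byzantine nodes and iterates *)
    (dO dZ : measure_display) (Omega : measurableType dO)
    (Z : measurableType dZ) (P : probability Omega R)
    (G : 'rV[R]_d -> Z -> 'rV[R]_d) (zeta : nat -> 'I_m -> Omega -> Z)
    (q : nat) (byz : nat -> Omega -> {set 'I_m})
    (Bz : nat -> 'I_m -> Omega -> 'rV[R]_d)
    (Agg : ('I_m -> 'rV[R]_d) -> 'rV[R]_d)
    (lr : nat -> R) (w0 : 'rV[R]_d) (w : nat -> Omega -> 'rV[R]_d)
    (g gt : nat -> 'I_m -> Omega -> 'rV[R]_d) (Ag : nat -> Omega -> 'rV[R]_d)
    (hbyz : forall k o, #|byz k o| = q)
    (hg : forall k i o, g k i o = G (w k o) (zeta k i o))
    (hgt : forall k i o,
       gt k i o = if i \in byz k o then Bz k i o else g k i o)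
    (hAg : forall k o, Ag k o = Agg (fun i => gt k i o))
    (hw0 : forall o, w 0%N o = w0)
    (hw : forall k o, w k.+1 o = w k o - lr k *: Ag k o)
    (* measurability; data i.i.d. across nodes *)
    (mzeta : forall k i, measurable_fun setT (zeta k i))
    (mg : forall k i, rvec_measurable measurable (g k i))
    (mBz : forall k i, rvec_measurable measurable (Bz k i))
    (mAg : forall k, rvec_measurable measurable (Ag k))
    (mw : forall k, rvec_measurable (past zeta k) (w k))
    (hiid : forall k, iid P (zeta k))
    (hlaw : forall k i j, same_cond_law P (past zeta k) (g k i) (g k j))
    (* the generic estimate G(w_k) is that of an arbitrary node i0 *)
    (i0 : 'I_m)
    (* smoothness *)
    (L Flow : R)
    (hsmooth : forall i, smooth L (Fi i))
    (hlow : forall i v, Flow <= Fi i v)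
    (* expected smoothness *)
    (A B C : R) (hA : 0 <= A) (hB : 0 <= B) (hC : 0 <= C)
    (hunb : forall k, {ae P, forall o,
       condexp_vec P (past zeta k) (g k i0) o = grad F (w k o)})
    (hES : forall k, {ae P, forall o,
       (cond_moment P (past zeta k) 2 (g k i0) o <=
        (2 * A * (F (w k o) - Flow) + B * enorm (grad F (w k o)) ^+ 2
         + C)%:E)%E})
    (* alpha-Byzantine resilience *)
    (hres1 : forall k, {ae P, forall o,
       (1 - sin alpha) * enorm (grad F (w k o)) ^+ 2 <=
       inner (condexp_vec P (past zeta k) (Ag k) o) (grad F (w k o))})
    (hres2 : forall r : nat, r \in [:: 2; 3; 4]%N ->
       exists s : seq (R * seq nat),
         all (fun t => sumn t.2 == r) s /\
         forall k, {ae P, forall o,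
           (cond_moment P (past zeta k) r (Ag k) o <=
            moment_combination s
              (fun e => cond_moment P (past zeta k) e (g k i0) o))%E})
    (* constants and learning rates *)
    (E : R)
    (hE : forall k, {ae P, forall o,
       (cond_moment P (past zeta k) 2 (Ag k) o <=
        E%:E * cond_moment P (past zeta k) 2 (g k i0) o)%E})
    (A' B' C' : R) (hA' : A' = A * E) (hB' : B' = B * E) (hC' : C' = C * E)
    (hLB : 0 < L * B')
    (hlr : forall k, lr k = (1 - sin alpha) / (L * B' * (k.+1)%:R `^ p))
    (Q : nat -> R) (hQ : forall K, Q K = \sum_(k < K) lr k ^+ 2)
    (delta0 : R) (hdelta0 : delta0 = F w0 - Flow)
    (K : nat) (hK : (1 <= K)%N),
    (\big[mine/+oo%E]_(k < K) 'E_P[fun o => enorm (grad F (w k o))] <=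
     (Num.sqrt (expR (L * A' * Q K) * (2 * delta0 + L * C' * Q K) /
                ((1 - sin alpha) * K%:R * lr K.-1)))%:E)%E /\
    ((K0 <= K)%N ->
     (\big[mine/+oo%E]_(k < K) 'E_P[fun o => enorm (grad F (w k o))] <=
      (c * (expR (A' / (2 * L * B' ^+ 2)) *
            Num.sqrt (2 * delta0 + C' / (L * B' ^+ 2)) *
            Num.sqrt (L * B') *
            (1 / K%:R `^ ((1 - p) / 2))))%:E)%E).
Proof.
have s1 : sin alpha < 1 := sin_lt1 R alpha halpha.
have /andP[p1 p2] := hp.
have sin0 : 0 <= sin alpha.
  have /andP[a0 a1] := halpha; apply: sin_ge0_pi; rewrite a0 (le_trans (ltW a1))//.
  by have := pi_gt0 R; lra.
set s := 1 - sin alpha.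
have s0 : 0 < s by rewrite subr_gt0.
have sle1 : s <= 1 by rewrite gerBl.
have [J [J0 tail]] := inv_powR_summable R p p1.
(* This is $(LB'\alpha_k)^2$, freed from the constants of the problem: it depends only on $\alpha$,
   $p$ and $k$. *)
pose b (k : nat) := s ^+ 2 * ((k.+1%:R `^ p) ^+ 2)^-1.
have pow1 (k : nat) : 1 <= k.+1%:R `^ p.
  by rewrite -[leLHS](powRr0 k.+1%:R) ler_powR ?ler1n//; lra.
have b01 k : 0 <= b k <= 1.
  rewrite mulr_ge0 ?invr_ge0 ?sqr_ge0//= mulr_ile1 ?sqr_ge0 ?invr_ge0 ?sqr_ge0//.
    by rewrite expr_le1// ltW.
  by rewrite invf_le1 ?exprn_ege1// exprn_gt0// (lt_le_trans ltr01).
have tailb K : \sum_(J <= k < K) b k <= 1 / 2.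
  rewrite -mulr_sumr; apply: le_trans (tail K); rewrite ler_piMl ?expr_le1 ?(ltW s0)//.
  by apply: sumr_ge0 => k _; rewrite invr_ge0 sqr_ge0.
(* The first [J] terms of [b] are at most 1 each, and the tail is at most $1/2$. *)
pose z : R := J%:R + 1.
have sumb K : \sum_(k < K) b k <= z.
  rewrite -(big_mkord xpredT b).
  apply: (@le_trans _ _ (\sum_(0 <= k < J) b k + \sum_(J <= k < K) b k)).
    case: (leqP J K) => JK; first by rewrite -big_cat_nat.
    rewrite [X in _ <= _ + X]big_geq ?(ltnW JK)// addr0.
    rewrite [leRHS](@big_cat_nat _ _ _ K)//= ?(ltnW JK)// lerDl.
    by apply: sumr_ge0 => k _; have /andP[] := b01 k.
  rewrite lerD//; last by apply: le_trans (tailb K) _; lra.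
  apply: (@le_trans _ _ (\sum_(0 <= k < J) 1)).
    by apply: ler_sum => k _; have /andP[] := b01 k.
  by rewrite sumr_const_nat subn0.
have z1 : 1 <= z by rewrite lerDr.
pose c1 : R := (2 * J%:R) ^+ J.
have c10 : 0 < c1 by rewrite exprn_gt0// mulr_gt0// ltr0n.
(* [c1] comes from the product, [z] from the sum of the squared rates, and $1/s$ from the
   denominator $sK\alpha_{K-1}$, which contains $s^2$. All depend on $\alpha$ and $p$ only, and the
   bound holds for every $K\ge1$. *)
pose c := Num.sqrt (c1 * z) / s.
have c0 : 0 < c by rewrite divr_gt0// sqrtr_gt0 mulr_gt0// (lt_le_trans ltr01).
exists c, 0%N; split=> // d m X Y V l f n hn x y Fi F hFi hF dO dZ Omega Z P G zeta q byz.
move=> Bz Agg lr w0 w g gt Ag hbyz hg hgt hAg hw0 hw mzeta mg mBz mAg mw hiid hlaw i0.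
move=> L Flow hsmooth hlow A B C hA hB hC hunb hES hres1 hres2 E hE A' B' C' hA' hB' hC' hLB.
move=> hlr Q hQ delta0 hdelta0 K hK.
have m0 : (0 < m)%N := leq_ltn_trans (leq0n i0) (ltn_ord i0).
have K0 : 0 < K%:R :> R by rewrite ltr0n.
(* For [d = 0] the hypotheses do not force [0 < L]. *)
case: (posnP d) => [d0|d0].
  have E0 : ('E_P[fun o => enorm (grad F (w 0%N o))] = 0)%E.
    rewrite (_ : (fun o => _) = cst 0) ?expectation_cst//; apply/funext => o.
    by rewrite /enorm /inner big1 ?sqrtr0// => i _; have := ltn_ord i; rewrite {2}d0.
  split=> [|_]; apply: le_trans (bigmin_le _ (Ordinal hK) _) _; rewrite /= E0 lee_fin.
    exact: sqrtr_ge0.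
  by rewrite mulr_ge0 ?(ltW c0)// !mulr_ge0 ?expR_ge0 ?sqrtr_ge0 ?invr_ge0 ?powR_ge0.
have smF := smooth_mean m L Fi F m0 hF hsmooth.
have L0 : 0 < L.
  rewrite lt_def (smooth_constant_ge0 L F)// andbT.
  by apply: contraTneq hLB => ->; rewrite mul0r ltxx.
have B'0 : 0 < B' by rewrite -(pmulr_rgt0 _ L0).
(* The sign of [E] follows from $BE=B'>0$ and $B\ge0$. *)
have E0 : 0 < E.
  rewrite ltNge; apply/negP => E0; move: B'0.
  by rewrite hB' ltNge mulr_ge0_le0.
have A'0 : 0 <= A' by rewrite hA' mulr_ge0// ltW.
have C'0 : 0 <= C' by rewrite hC' mulr_ge0// ltW.
have lowF v : Flow <= F v.
  rewrite hF ler_pdivlMl ?ltr0n//.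
  rewrite mulr_natl -[m in _ *+ m]card_ord -sumr_const.
  by apply: ler_sum => i _; exact: hlow.
have mom k : {ae P, forall o, (cond_moment P (past zeta k) 2 (Ag k) o <=
     (2 * A' * (F (w k o) - Flow) + B' * enorm (grad F (w k o)) ^+ 2 + C')%:E)%E}.
  apply: filterS2 (hES k) (hE k) => o h1 h2; apply: le_trans h2 _.
  apply: le_trans (_ : (E%:E * (2 * A * (F (w k o) - Flow) +
    B * enorm (grad F (w k o)) ^+ 2 + C)%:E <= _)%E).
    by rewrite lee_pmul2l ?lte_fin// fin_numE.
  by rewrite -EFinM lee_fin hA' hB' hC'; lra.
have pow0 (k : nat) : 0 < k.+1%:R `^ p :> R by rewrite powR_gt0.
have lr0 k : 0 < lr k by rewrite hlr divr_gt0// mulr_gt0.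
have lrs k : L * B' * lr k <= s.
  rewrite hlr -/s [leLHS](_ : _ = s / k.+1%:R `^ p); last first.
    by field; rewrite !gt_eqF.
  by rewrite ler_pdivrMr// ler_peMr// ltW.
have lrd : {homo lr : i j / (i <= j)%N >-> j <= i}.
  move=> i j ij; rewrite !hlr ler_pM2l// lef_pV2 ?posrE ?mulr_gt0// ler_pM2l//.
  by rewrite ge0_ler_powR ?nnegrE ?ler0n ?ler_nat//; lra.
have main := min_expected_grad_le dO dZ Omega Z R P m d zeta F L Flow w Ag w0 lr s A' B' C' K
  mzeta L0 smF lowF hw0 hw mw mAg A'0 (ltW B'0) C'0 mom hres1 s0 lr0 lrs lrd hK.
rewrite -hdelta0 -hQ in main.
have dl0 : 0 <= delta0 by rewrite hdelta0 subr_ge0.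
have den0 : 0 < s * K%:R * lr K.-1 by rewrite !mulr_gt0.
have Q0 : 0 <= Q K by rewrite hQ sumr_ge0// => k _; exact: sqr_ge0.
have num0 : 0 <= 2 * delta0 + L * C' * Q K.
  by rewrite addr_ge0 ?mulr_ge0// ltW.
split=> [|_]; apply: le_trans main _; rewrite lee_fin.
  (* First bound: each factor $1+u$ is at most $e^u$, and the exponents add up to $LA'Q_K$. *)
  apply: ler_wsqrtr; rewrite ler_pM2r ?invr_gt0// ler_wpM2r// hQ mulr_sumr.
  rewrite expR_sum; apply: ler_prod => k _.
  by rewrite expR_ge1Dx andbT addr_ge0// mulr_ge0 ?sqr_ge0// mulr_ge0// ltW.
(* Second bound: $LA'\alpha_k^2 = x_0 b_k$, so [prod_1D_le_expR] applies with exponent exactly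
   $x_0$, twice the exponent in the claim before the square root. *)
set x0 := A' / (L * B' ^+ 2).
have x00 : 0 <= x0 by rewrite divr_ge0// mulr_ge0 ?sqr_ge0// ltW.
have lrE k : lr k ^+ 2 = b k / (L * B') ^+ 2.
  by rewrite hlr -/s /b; field; rewrite !gt_eqF.
set Pr := \prod_(k < K) _.
have PrE : Pr <= c1 * expR x0.
  rewrite /Pr (eq_bigr (fun k : 'I_K => 1 + x0 * b k)); last first.
    by move=> k _; congr (1 + _); rewrite lrE /x0; field; rewrite !gt_eqF.
  exact: prod_1D_le_expR.
have Pr0 : 0 <= Pr.
  by apply: prodr_ge0 => k _; rewrite addr_ge0// mulr_ge0 ?sqr_ge0// mulr_ge0// ltW.
set y0 := C' / (L * B' ^+ 2).
have y00 : 0 <= y0 by rewrite divr_ge0// mulr_ge0 ?sqr_ge0// ltW.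
have numE : 2 * delta0 + L * C' * Q K <= z * (2 * delta0 + y0).
  have -> : L * C' * Q K = y0 * \sum_(k < K) b k.
    rewrite hQ !mulr_sumr; apply: eq_bigr => k _.
    by rewrite lrE /y0; field; rewrite !gt_eqF.
  rewrite mulrDr lerD//; first by rewrite ler_peMl// mulr_ge0.
  by rewrite [leRHS]mulrC ler_wpM2l.
(* The rate $\alpha_{K-1}$ contains $K^p$, as its index is shifted by one; dividing $K$ by it leaves
   $K^{1-p}$. *)
have KpE : K%:R = K%:R `^ p * K%:R `^ (1 - p) :> R.
  rewrite -powRD; first by rewrite addrC subrK powRr1// ltW.
  by apply/implyP => _; rewrite gt_eqF.
have Kp0 : 0 < K%:R `^ p :> R by rewrite powR_gt0.
have Kq0 : 0 < K%:R `^ (1 - p) :> R by rewrite powR_gt0.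
have denE : (s * K%:R * lr K.-1)^-1 = L * B' / (s ^+ 2 * K%:R `^ (1 - p)).
  rewrite hlr -/s prednK// {1}KpE; field.
  by rewrite !gt_eqF.
set rhs := c * _.
have rhs0 : 0 <= rhs.
  by rewrite mulr_ge0 ?(ltW c0)// !mulr_ge0 ?expR_ge0 ?sqrtr_ge0 ?invr_ge0 ?powR_ge0.
(* The claimed bound is nonnegative, so it suffices to compare squares. *)
rewrite -[leRHS]ger0_norm// -sqrtr_sqr; apply: ler_wsqrtr.
have -> : rhs ^+ 2 =
    (c1 * expR x0) * (z * (2 * delta0 + y0)) * (L * B' / (s ^+ 2 * K%:R `^ (1 - p))).
  have z0 : 0 <= c1 * z by rewrite mulr_ge0 ?(ltW c10)// (le_trans ler01).
  have y1 : 0 <= 2 * delta0 + y0 by rewrite addr_ge0// mulr_ge0.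
  rewrite /rhs /c !exprMn -expRM_natl (sqr_sqrtr z0) (sqr_sqrtr y1) (sqr_sqrtr (ltW hLB)).
  rewrite !exprVn expr1n powR_half_sqr//.
  have -> : 2%:R * (A' / (2 * L * B' ^+ 2)) = x0 by rewrite /x0; field; rewrite !gt_eqF.
  by field; rewrite !gt_eqF.
rewrite denE; apply: ler_wpM2r; first by rewrite divr_ge0 ?mulr_ge0 ?sqr_ge0 ?powR_ge0// ltW.
exact: ler_pM.
Qed.
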